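(* Let $p\ge 3$ be a prime and let $H=\mathrm{Dist}(SL_2)$ be the algebra of distributions supported at the identity of the algebraic group $SL_2$ over $\mathbb{F}_p$. Let $T$ be an $\mathbb{F}_p$-split maximal torus of $SL_2$ and let $\{e,f,h\}$ be a standard basis of $\mathfrak{sl}_2(\mathbb{F}_p)=\mathrm{Lie}(SL_2)$ such that $h$ spans $\mathrm{Lie}(T)$, with associated divided powers $e^{(m)},f^{(m)}\in H$ ($m\ge 0$). Then the unital associative $\mathbb{F}_p$-algebra $H$ is generated by the elements $e,e^{(p)},e^{(p^2)},\ldots$ and $f,f^{(p)},f^{(p^2)},\ldots$ subject to the following relations (i.e. these relations hold in $H$ and they are a complete set of defining relations for these generators), where $X_k:=[e^{(p^k)},f^{(p^k)}]$ and the relations are imposed for all integers $k\geq 0$ and $n>0$: \begin{enumerate} \item $[X_k,e^{(p^k)}]=2e^{(p^k)}$, $\;[X_k,f^{(p^k)}]=-2f^{(p^k)}$; \item $[X_k,e^{(p^{k+n})}]=0=[X_k,f^{(p^{k+n})}]$; \item $[e^{(p^k)},e^{(p^{k+n})}]=0=[f^{(p^k)},f^{(p^{k+n})}]$; \item $[e^{(p^k)},f^{(p^{k+n})}]=(-1)^{n}(f^{(p^k)})^{p-1}(f^{(p^{k+1})})^{p-1}\cdots (f^{(p^{k+n-1})})^{p-1}(X_k+1)$ and $[e^{(p^{k+n})},f^{(p^{k})}]=(-1)^{n}(X_k+1)(e^{(p^k)})^{p-1}(e^{(p^{k+1})})^{p-1}\cdots (e^{(p^{k+n-1})})^{p-1}$;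 \item $(e^{(p^k)})^p=0=(f^{(p^k)})^p$; \item $X_k^p=X_k$. \end{enumerate}
   Context: $[a,b]=ab-ba$. A standard basis $\{e,f,h\}$ of $\mathfrak{sl}_2$ satisfies $[h,e]=2e$, $[h,f]=-2f$, $[e,f]=h$. Description of $H$ (Kostant's $\mathbb{Z}$-form): let $e,f,h$ also denote the lifted standard basis of $\mathfrak{sl}_2$ over $\mathbb{Z}$ (up to an automorphism of $SL_2$ given by conjugation by an element of $GL_2(\mathbb{F}_p)$, one may take the usual matrices and $T$ the diagonal torus). In the universal enveloping algebra $U((\mathfrak{sl}_2)_{\mathbb{Q}})$ put $e^{(m)}=e^m/m!$, $f^{(m)}=f^m/m!$, $\binom{h}{m}=h(h-1)\cdots(h-m+1)/m!$. The integral distribution algebra is the subring $$\mathrm{Dist}((SL_2)_{\mathbb{Z}})=\mathrm{span}_{\mathbb{Z}}\left\{f^{(a)}\binom{h}{b}e^{(c)} : a,b,c\in\mathbb{Z}_{\ge 0}\right\}\subset U((\mathfrak{sl}_2)_{\mathbb{Q}}),$$ which is free over $\mathbb{Z}$ on these elements, and $H=\mathrm{Dist}((SL_2)_{\mathbb{Z}})\otimes_{\mathbb{Z}}\mathbb{F}_p$. The images of $e^{(m)},f^{(m)},\binom{h}{m}$ in $H$ are denoted by the same symbols; $e=e^{(1)}$, $f=f^{(1)}$. *)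

(* Defs.v *)
From HB Require Import structures.
From mathcomp Require Import all_boot all_order all_algebra all_field.
From mathcomp Require Import boolp finmap monalg ring lra.

Set Implicit Arguments.
Unset Strict Implicit.
Unset Printing Implicit Defensive.

Import Order.TTheory GRing.Theory Num.Theory.

Local Open Scope ring_scope.
Local Open Scope quotient_scope.

Definition brk (R : nzRingType) (x y : R) : R := x * y - y * x.

(* The two-sided ideal generated by the differences u - v with S u v. *)
Inductive ideal_gen (R : nzRingType) (S : R -> R -> Prop) : R -> Prop :=
| ideal_gen0 : ideal_gen S 0
| ideal_genD (a u v b w : R) :
    S u v -> ideal_gen S w -> ideal_gen S (a * (u - v) * b + w).

Section IdealGen.
Variables (R : nzRingType) (S : R -> R -> Prop).

Lemma ideal_gen_add (x y : R) :
  ideal_gen S x -> ideal_gen S y -> ideal_gen S (x + y).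
Proof.
elim=> [|a u v b w uv _ IH] Sy; first by rewrite add0r.
by rewrite -addrA; apply: ideal_genD => //; apply: IH.
Qed.

Lemma ideal_gen_opp (x : R) : ideal_gen S x -> ideal_gen S (- x).
Proof.
elim=> [|a u v b w uv _ IH]; first by rewrite oppr0; exact: ideal_gen0.
by rewrite opprD -!mulNr; apply: ideal_genD.
Qed.

Lemma ideal_gen_mull (c x : R) : ideal_gen S x -> ideal_gen S (c * x).
Proof.
elim=> [|a u v b w uv _ IH]; first by rewrite mulr0; exact: ideal_gen0.
by rewrite mulrDr !mulrA; apply: ideal_genD.
Qed.

Lemma ideal_gen_mulr (c x : R) : ideal_gen S x -> ideal_gen S (x * c).
Proof.
elim=> [|a u v b w uv _ IH]; first by rewrite mul0r; exact: ideal_gen0.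
by rewrite mulrDl -mulrA; apply: ideal_genD.
Qed.

Lemma ideal_gen_ker (T : nzRingType) (f : {rmorphism R -> T}) :
  (forall u v, S u v -> f u = f v) -> forall x, ideal_gen S x -> f x = 0.
Proof.
move=> Sf x; elim=> [|a u v b w uv _ IH]; first by rewrite rmorph0.
by rewrite rmorphD !rmorphM rmorphB (Sf _ _ uv) subrr mulr0 mul0r add0r IH.
Qed.

End IdealGen.

(* The ring quotients of ring_quotient require a commutative ring; here are
   the quotients of an arbitrary ring by a proper two-sided ideal. *)
HB.mixin Record isRightStable (R : nzRingType) (S : R -> bool) := {
  right_stable_subproof :
    forall a, {in (S : {pred R}), forall u, u * a \in (S : {pred R})}
}.

#[short(type="ideal2")]
HB.structure Definition Ideal2 (R : nzRingType) :=
  {S of Idealr R S & isRightStable R S}.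

Definition quot2 (R : nzRingType) (I : ideal2 R) : Type := Quotient.quot I.

Section Quot2.
Variables (R : nzRingType) (I : ideal2 R).
Local Notation Q := (quot2 I).

HB.instance Definition _ := GRing.Zmodule.copy Q (Quotient.quot I).

Definition to_quot2 (x : R) : Q := \pi_(Quotient.quot I) x.

Lemma to_quot2_eq (x y : R) : to_quot2 x = to_quot2 y <-> x - y \in I.
Proof.
rewrite /to_quot2; split; first by move/eqP; rewrite -Quotient.idealrBE.
by move=> xy; apply/eqP; rewrite -Quotient.idealrBE.
Qed.

Definition rep2 (q : Q) : R := repr (q : Quotient.quot I).

Lemma rep2K (q : Q) : to_quot2 (rep2 q) = q.
Proof. exact: reprK. Qed.

Lemma to_quot2_is_zmod_morphism : zmod_morphism to_quot2.
Proof. exact: raddfB. Qed.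

HB.instance Definition _ :=
  GRing.isZmodMorphism.Build R Q to_quot2 to_quot2_is_zmod_morphism.

Definition one2 : Q := to_quot2 1.
Definition mul2 (q r : Q) : Q := to_quot2 (rep2 q * rep2 r).

Lemma to_quot2M (x y : R) : mul2 (to_quot2 x) (to_quot2 y) = to_quot2 (x * y).
Proof.
apply/to_quot2_eq.
set x' := rep2 _; set y' := rep2 _.
have Ix : x' - x \in I by apply/to_quot2_eq; rewrite rep2K.
have Iy : y' - y \in I by apply/to_quot2_eq; rewrite rep2K.
have -> : x' * y' - x * y = x' * (y' - y) + (x' - x) * y.
  by rewrite mulrBr mulrBl addrA subrK.
by apply: rpredD; [exact: idealMr | exact: right_stable_subproof].
Qed.

Lemma mul2A : associative mul2.
Proof.
by move=> x y z; rewrite -[x]rep2K -[y]rep2K -[z]rep2K !to_quot2M mulrA.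
Qed.
Lemma mul12 : left_id one2 mul2.
Proof. by move=> x; rewrite -[x]rep2K to_quot2M mul1r. Qed.
Lemma mul21 : right_id one2 mul2.
Proof. by move=> x; rewrite -[x]rep2K to_quot2M mulr1. Qed.
Lemma mul2Dl : left_distributive mul2 +%R.
Proof.
move=> x y z; rewrite -[x]rep2K -[y]rep2K -[z]rep2K.
by rewrite -raddfD !to_quot2M -raddfD mulrDl.
Qed.
Lemma mul2Dr : right_distributive mul2 +%R.
Proof.
move=> x y z; rewrite -[x]rep2K -[y]rep2K -[z]rep2K.
by rewrite -raddfD !to_quot2M -raddfD mulrDr.
Qed.
Lemma one2_neq0 : one2 != 0.
Proof.
apply/eqP; rewrite -(raddf0 to_quot2) => /to_quot2_eq.
by rewrite subr0 idealr1.
Qed.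

HB.instance Definition _ := GRing.Zmodule_isNzRing.Build Q
  mul2A mul12 mul21 mul2Dl mul2Dr one2_neq0.

Lemma to_quot2_is_monoid_morphism : monoid_morphism to_quot2.
Proof. by split=> // x y; rewrite -to_quot2M. Qed.

HB.instance Definition _ :=
  GRing.isMonoidMorphism.Build R Q to_quot2 to_quot2_is_monoid_morphism.

End Quot2.

Section Quot2Alg.
Variables (K : comNzRingType) (A : algType K) (I : ideal2 A).
Local Notation Q := (quot2 I).

Definition scale2 (c : K) (q : Q) : Q := to_quot2 I (c *: rep2 q).

Lemma to_quot2Z (c : K) (x : A) :
  scale2 c (to_quot2 I x) = to_quot2 I (c *: x).
Proof.
apply/to_quot2_eq; rewrite -scalerBr -[_ - _]mul1r scalerAl; apply: idealMr.
by apply/to_quot2_eq; rewrite rep2K.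
Qed.

Lemma scale2A (a b : K) (q : Q) : scale2 a (scale2 b q) = scale2 (a * b) q.
Proof. by rewrite -[q]rep2K !to_quot2Z scalerA. Qed.
Lemma scale21 : left_id 1 scale2.
Proof. by move=> q; rewrite -[q]rep2K !to_quot2Z scale1r. Qed.
Lemma scale2Dr : right_distributive scale2 +%R.
Proof.
move=> a x y; rewrite -[x]rep2K -[y]rep2K -raddfD !to_quot2Z.
by rewrite -(raddfD (to_quot2 I)) scalerDr.
Qed.
Lemma scale2Dl (q : Q) : {morph scale2^~ q : a b / a + b}.
Proof.
move=> a b; rewrite -[q]rep2K !to_quot2Z.
by rewrite -(raddfD (to_quot2 I)) scalerDl.
Qed.

HB.instance Definition _ := GRing.Zmodule_isLmodule.Build K Q
  scale2A scale21 scale2Dr scale2Dl.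

Lemma scale2Al (a : K) (x y : Q) : a *: (x * y) = (a *: x) * y.
Proof.
have sE (q : Q) : a *: q = scale2 a q by [].
rewrite -[x]rep2K -[y]rep2K -rmorphM !sE !to_quot2Z.
by rewrite -(rmorphM (to_quot2 I)) scalerAl.
Qed.
HB.instance Definition _ := GRing.Lmodule_isLalgebra.Build K Q scale2Al.

Lemma scale2Ar (a : K) (x y : Q) : a *: (x * y) = x * (a *: y).
Proof.
have sE (q : Q) : a *: q = scale2 a q by [].
rewrite -[x]rep2K -[y]rep2K -rmorphM !sE !to_quot2Z.
by rewrite -(rmorphM (to_quot2 I)) scalerAr.
Qed.
HB.instance Definition _ := GRing.Lalgebra_isAlgebra.Build K Q scale2Ar.

Lemma to_quot2_is_scalable : scalable (to_quot2 I).
Proof. by move=> c x; rewrite -to_quot2Z. Qed.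
HB.instance Definition _ :=
  GRing.isScalable.Build K A Q *:%R (to_quot2 I) to_quot2_is_scalable.

End Quot2Alg.

Lemma malg_scaleAr (K : comNzRingType) (M : monomType) (c : K)
  (u v : {malg K[M]}) : c *: (u * v) = u * (c *: v).
Proof.
apply/malgP => k; rewrite mcoeffZ (mcoeffMl u v k).
rewrite (mcoeffMlw k (fsubset_refl (msupp u)) (msuppZ_le c v)).
rewrite mulr_sumr; apply: eq_bigr => k1 _.
rewrite mulr_sumr; apply: eq_bigr => k2 _.
by rewrite mcoeffZ mulrnAr mulrCA.
Qed.

(* The free associative unital algebra K<G>. *)
Definition free_alg (K : comNzRingType) (G : choiceType) : Type :=
  {malg K[{fmonom G}]}.

Section FreeAlg.
Variables (K : comNzRingType) (G : choiceType).
Local Notation F := (free_alg K G).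

HB.instance Definition _ := GRing.Lalgebra.copy F {malg K[{fmonom G}]}.

Lemma free_alg_scaleAr (c : K) (x y : F) : c *: (x * y) = x * (c *: y).
Proof. exact: malg_scaleAr. Qed.

HB.instance Definition _ := GRing.Lalgebra_isAlgebra.Build K F free_alg_scaleAr.

Definition free_gen (g : G) : F := << fmu g >>.

(* The algebra morphism K<G> -> A with g |-> f g. *)
Definition free_eval (A : algType K) (f : G -> A) (w : F) : A :=
  \sum_(m <- msupp w) w@_m *: \prod_(g <- (m : {fmonom G}) : seq G) f g.

(* The augmentation, sending every generator to 0. *)
Definition counit (w : F) : K := mcoeff (@mone {fmonom G}) w.

Lemma counitB : {morph counit : x y / x - y}.
Proof. exact: (@mcoeffB {fmonom G} K). Qed.

Lemma counit_is_monoid_morphism : monoid_morphism counit.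
Proof. by have [cM c1] := @mcoeff1g_is_multiplicative {fmonom G} K; split. Qed.

HB.instance Definition _ := GRing.isZmodMorphism.Build F K counit counitB.
HB.instance Definition _ :=
  GRing.isMonoidMorphism.Build F K counit counit_is_monoid_morphism.

Lemma counitZ (c : K) (x : F) : counit (c *: x) = c * counit x.
Proof. exact: mcoeffZ. Qed.

Lemma counit_gen (g : G) : counit (free_gen g) = 0.
Proof.
rewrite /counit /free_gen mcoeffU1; case: eqP => //.
by move/(congr1 (@fdeg G)); rewrite fdegU fdeg1.
Qed.

Lemma counit_brk (x y : F) : counit (brk x y) = 0.
Proof.
have [_ cM] := counit_is_monoid_morphism.
transitivity (counit x * counit y - counit y * counit x).
  by rewrite /brk counitB; congr (_ - _); exact: cM.
by rewrite mulrC subrr.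
Qed.

End FreeAlg.

(* The elements gen g generate A, and rel is a complete set of defining
   relations between them: A is the quotient of K<G> by the ideal of rel. *)
Definition presented_by (K : comNzRingType) (G : choiceType) (A : algType K)
    (gen : G -> A) (rel : free_alg K G -> free_alg K G -> Prop) : Prop :=
  (forall a : A, exists w : free_alg K G, free_eval gen w = a) /\
  (forall w : free_alg K G, free_eval gen w = 0 <-> ideal_gen rel w).

Section Enveloping.
Variables (K : comNzRingType) (V : lmodType K) (br : V -> V -> V).
Local Notation "[[ x ]]" := (free_gen K x).

Inductive env_rel : free_alg K V -> free_alg K V -> Prop :=
| env_rel_lin (c : K) (x y : V) : env_rel [[c *: x + y]] (c *: [[x]] + [[y]])
| env_rel_brk (x y : V) : env_rel (brk [[x]] [[y]]) [[br x y]].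

Definition env_ideal : {pred free_alg K V} :=
  [pred w | `[< ideal_gen env_rel w >]].

Lemma env_ideal_counit (w : free_alg K V) : w \in env_ideal -> counit w = 0.
Proof.
have Sf u v : env_rel u v -> counit u = counit v.
  case=> [c x y|x y]; last by rewrite counit_brk counit_gen.
  by rewrite raddfD /= counitZ !counit_gen mulr0 addr0.
by move=> /asboolP Iw; exact: (ideal_gen_ker Sf Iw).
Qed.

Lemma env_idealr_closed : idealr_closed env_ideal.
Proof.
split.
- by apply/asboolP; exact: ideal_gen0.
- by apply/negP => /env_ideal_counit; rewrite rmorph1 => /eqP; rewrite oner_eq0.
move=> a u v /asboolP Iu /asboolP Iv; apply/asboolP.
by apply: ideal_gen_add => //; exact: ideal_gen_mull.
Qed.
HB.instance Definition _ := isIdealr.Build _ env_ideal env_idealr_closed.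

Lemma env_ideal_right : forall a, {in env_ideal, forall u, u * a \in env_ideal}.
Proof. by move=> a u /asboolP Iu; apply/asboolP; exact: ideal_gen_mulr. Qed.
HB.instance Definition _ := isRightStable.Build _ env_ideal env_ideal_right.

(* The universal enveloping algebra of the Lie algebra (V, br). *)
Definition env : Type := quot2 env_ideal.
HB.instance Definition _ := GRing.Algebra.on env.

Definition env_in (x : V) : env := to_quot2 env_ideal [[x]].

Lemma env_in_lin (c : K) (x y : V) :
  env_in (c *: x + y) = c *: env_in x + env_in y.
Proof.
rewrite /env_in -(linearP (to_quot2 env_ideal)); apply/to_quot2_eq/asboolP.
have := ideal_genD 1 1 (env_rel_lin c x y) (ideal_gen0 _).
by rewrite mul1r mulr1 addr0.
Qed.

Lemma env_in_brk (x y : V) : brk (env_in x) (env_in y) = env_in (br x y).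
Proof.
rewrite /env_in /brk -!rmorphM -rmorphB; apply/to_quot2_eq/asboolP.
have := ideal_genD 1 1 (env_rel_brk x y) (ideal_gen0 _).
by rewrite mul1r mulr1 addr0.
Qed.

Lemma env_in0 : env_in 0 = 0.
Proof.
have := env_in_lin 1 0 0; rewrite !scale1r addr0 => H.
by apply: (addrI (env_in 0)); rewrite addr0 -H.
Qed.

Lemma env_inZ (c : K) (x : V) : env_in (c *: x) = c *: env_in x.
Proof. by have := env_in_lin c x 0; rewrite env_in0 !addr0. Qed.

Definition env_counit (u : env) : K := counit (rep2 u).

Lemma env_counitE (w : free_alg K V) :
  env_counit (to_quot2 env_ideal w) = counit w.
Proof.
apply/eqP; rewrite -subr_eq0 -rmorphB; apply/eqP/env_ideal_counit.
by apply/to_quot2_eq; rewrite rep2K.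
Qed.

Lemma env_counitB : {morph env_counit : x y / x - y}.
Proof.
move=> x y; rewrite -[x]rep2K -[y]rep2K -rmorphB !env_counitE.
exact: counitB.
Qed.

Lemma env_counit_is_monoid_morphism : monoid_morphism env_counit.
Proof.
have [c1 cM] := @counit_is_monoid_morphism K V; split.
  rewrite -[1]/(to_quot2 env_ideal 1) env_counitE; exact: c1.
move=> x y; rewrite -[x]rep2K -[y]rep2K -rmorphM !env_counitE; exact: cM.
Qed.

Lemma env_counitZ (c : K) (x : env) : env_counit (c *: x) = c * env_counit x.
Proof.
rewrite -[x]rep2K -[_ *: _]/(scale2 c _) to_quot2Z !env_counitE.
exact: counitZ.
Qed.

Lemma env_counit_in (x : V) : env_counit (env_in x) = 0.
Proof. by rewrite env_counitE counit_gen. Qed.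

End Enveloping.

HB.instance Definition _ (K : comNzRingType) (V : lmodType K) br :=
  GRing.isZmodMorphism.Build (@env K V br) K (@env_counit K V br)
    (@env_counitB K V br).
HB.instance Definition _ (K : comNzRingType) (V : lmodType K) br :=
  GRing.isMonoidMorphism.Build (@env K V br) K (@env_counit K V br)
    (@env_counit_is_monoid_morphism K V br).

Section Sl2.
Variable R : comNzRingType.

Definition traceless : {pred 'M[R]_2} := [pred x | \tr x == 0].

Lemma traceless_submod : submod_closed traceless.
Proof.
split=> [|c x y]; rewrite !inE ?mxtrace0 // => /eqP x0 /eqP y0.
by rewrite mxtraceD mxtraceZ x0 y0 mulr0 addr0.
Qed.
HB.instance Definition _ :=
  GRing.isSubmodClosed.Build R 'M[R]_2 traceless traceless_submod.

Record sl2 : Type := Sl2 { sl2_mx : 'M[R]_2; _ : sl2_mx \in traceless }.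
HB.instance Definition _ := [isSub for sl2_mx].
HB.instance Definition _ := [Choice of sl2 by <:].
HB.instance Definition _ := [SubChoice_isSubLmodule of sl2 by <:].

Lemma sl2_brk_proof (x y : sl2) :
  sl2_mx x *m sl2_mx y - sl2_mx y *m sl2_mx x \in traceless.
Proof. by rewrite inE raddfB /= mxtrace_mulC subrr. Qed.

Definition sl2_brk (x y : sl2) : sl2 := Sl2 (sl2_brk_proof x y).

Definition sl2_std_basis (e f h : sl2) : Prop :=
  [/\ sl2_brk h e = 2%:R *: e, sl2_brk h f = - (2%:R *: f), sl2_brk e f = h
    & forall x : sl2, exists! c : R * R * R,
        x = c.1.1 *: e + c.1.2 *: f + c.2 *: h].

End Sl2.

Definition zspan (I : Type) (V : zmodType) (F : I -> V) (x : V) : Prop :=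
  exists s : seq (int * I), x = \sum_(t <- s) F t.2 *~ t.1.

Section ZSpan.
Variables (I : Type) (V : zmodType) (F : I -> V).

Lemma zspan0 : zspan F 0.
Proof. by exists [::]; rewrite big_nil. Qed.

Lemma zspan_mem (i : I) : zspan F (F i).
Proof. by exists [:: (1, i)]; rewrite big_seq1. Qed.

Lemma zspanD (x y : V) : zspan F x -> zspan F y -> zspan F (x + y).
Proof. by move=> [s ->] [t ->]; exists (s ++ t); rewrite big_cat. Qed.

Lemma zspanMz (x : V) (n : int) : zspan F x -> zspan F (x *~ n).
Proof.
move=> [s ->]; exists [seq (t.1 * n, t.2) | t <- s]; rewrite big_map /= mulrz_suml.
by apply: eq_bigr => t _; rewrite mulrzA.
Qed.

Lemma zspanN (x : V) : zspan F x -> zspan F (- x).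
Proof. by move=> /(zspanMz (-1)); rewrite mulrN1z. Qed.

Lemma zspan_sum (J : Type) (r : seq J) (G : J -> V) :
  (forall j, zspan F (G j)) -> zspan F (\sum_(j <- r) G j).
Proof.
move=> FG; elim: r => [|j r IH]; first by rewrite big_nil; exact: zspan0.
by rewrite big_cons; apply: zspanD.
Qed.

End ZSpan.

Section Kostant.
Variables (A : algType rat) (e f h : A).

Definition divpow (x : A) (m : nat) : A := (m`!%:R : rat)^-1 *: x ^+ m.
Definition binomA (x : A) (m : nat) : A :=
  (m`!%:R : rat)^-1 *: \prod_(i < m) (x - (i : nat)%:R).

Definition kostant_mon (t : nat * nat * nat) : A :=
  divpow f t.1.1 * binomA h t.1.2 * divpow e t.2.

Definition kostant_form : A -> Prop := zspan kostant_mon.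

Hypotheses (he : brk h e = 2%:R *: e) (hf : brk h f = - (2%:R *: f))
  (ef : brk e f = h).

Let phi : {rmorphism {poly rat} -> A} := horner_alg h.

Let binp (m : nat) : {poly rat} :=
  (m`!%:R : rat)^-1 *: \prod_(i < m) ('X - (i : nat)%:R%:P).

Let phiX : phi 'X = h. Proof. exact: horner_algX. Qed.
Let phiC (c : rat) : phi c%:P = c%:A. Proof. exact: horner_algC. Qed.
Let phiZ (c : rat) (P : {poly rat}) : phi (c *: P) = c *: phi P.
Proof. by rewrite -mul_polyC rmorphM phiC mulr_algl. Qed.

Let phi_binp (m : nat) : phi (binp m) = binomA h m.
Proof.
rewrite /binp /binomA phiZ rmorph_prod; congr (_ *: _).
apply: eq_bigr => i _; rewrite rmorphB phiX; congr (_ - _).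
by rewrite phiC scaler_nat.
Qed.

Let fact_neq0 (m : nat) : (m`!%:R : rat) != 0.
Proof. by rewrite pnatr_eq0 -lt0n fact_gt0. Qed.

Let binpS (m : nat) : m.+1%:R *: binp m.+1 = ('X - (m%:R)%:P) * binp m.
Proof.
rewrite /binp big_ord_recr /= scalerA factS natrM invfM mulrA divff ?pnatr_eq0 //.
by rewrite mul1r -scalerAr mulrC.
Qed.

Let binp0 : binp 0 = 1.
Proof. by rewrite /binp big_ord0 fact0 invr1 scale1r. Qed.

Let shift (n : int) : {poly rat} := 'X + (n%:~R)%:P.

Let binpX (m : nat) (x : rat) :
  m.+1%:R * (binp m.+1).[x] = (x - m%:R) * (binp m).[x].
Proof. by rewrite -hornerZ binpS !hornerE. Qed.

Let binp_pascal (m : nat) (x : rat) :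
  (binp m.+1).[x + 1] = (binp m.+1).[x] + (binp m).[x].
Proof.
elim: m x => [|m IH] x.
  have := binpX 0 x; have := binpX 0 (x + 1); rewrite binp0 !hornerE => -> ->.
  by ring.
have nz : m.+2%:R != 0 :> rat by rewrite pnatr_eq0.
apply: (mulfI nz); rewrite mulrDr !binpX IH.
have := binpX m x; rewrite -!natr1 => H.
transitivity ((x - (m%:R + 1)) * (binp m.+1).[x] + (binp m.+1).[x]
  + ((x - m%:R) * (binp m).[x])); first by ring.
by rewrite -H; ring.
Qed.

(* Integer-valued polynomials. *)
Let IV (P : {poly rat}) := forall z : int, P.[z%:~R] \is a Num.int.

Let IV_binp (m : nat) : IV (binp m).
Proof.
elim: m => [|m IH] z; first by rewrite binp0 hornerE.
have base : (binp m.+1).[0] \is a Num.int.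
  by rewrite /binp hornerZ big_ord_recl hornerM hornerXsubC subrr mul0r mulr0.
elim/int_rec: z => [|n IHn|n IHn]; first by rewrite mulr0z.
  rewrite intS addrC rmorphD /= binp_pascal rpredD //.
have := binp_pascal m ((- n.+1%:Z)%:~R).
have -> : ((- n.+1%:Z)%:~R + 1 : rat) = (- n%:Z)%:~R.
  by rewrite intS opprD rmorphD /= rmorphN1 addrAC addNr add0r.
by move=> H; rewrite -[X in X \is a _](addrK (binp m).[(- n.+1%:Z)%:~R]) -H rpredB.
Qed.

Let IV_shift (P : {poly rat}) (n : int) : IV P -> IV (P \Po shift n).
Proof.
by move=> IVP z; rewrite horner_comp /shift !hornerE -rmorphD; exact: IVP.
Qed.

Let IV_mul (P Q : {poly rat}) : IV P -> IV Q -> IV (P * Q).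
Proof. by move=> IP IQ z; rewrite hornerM rpredM. Qed.

Let binp_root (m j : nat) : (j < m)%N -> (binp m).[j%:R] = 0.
Proof.
move=> jm; rewrite /binp hornerZ horner_prod (bigD1 (Ordinal jm)) //=.
by rewrite hornerXsubC subrr mul0r mulr0.
Qed.

Let binp_diag (m : nat) : (binp m).[m%:R] = 1.
Proof.
elim: m => [|m IH]; first by rewrite binp0 hornerE.
by rewrite -natr1 binp_pascal IH binp_root ?add0r.
Qed.

Let size_binp (m : nat) : (size (binp m) <= m.+1)%N.
Proof.
apply: leq_trans (size_scale_leq _ _) _.
by rewrite size_prod_XsubC /index_enum -enumT size_enum_ord.
Qed.

Let newton (P : {poly rat}) : IV P -> exists c : nat -> int,
  P = \sum_(b < size P) (c b)%:~R *: binp b.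
Proof.
move=> IP.
suff main : forall m, exists c : nat -> int, forall j, (j < m)%N ->
    P.[j%:R] = (\sum_(b < m) (c b)%:~R *: binp b).[j%:R].
  have [c Hc] := main (size P).
  exists c; apply/eqP; rewrite -subr_eq0; set D := P - _.
  have sD : (size D <= size P)%N.
    rewrite (leq_trans (size_polyD _ _)) // geq_max leqnn size_polyN.
    apply: (leq_trans (size_sum _ _ _)); apply/bigmax_leqP => b _.
    by rewrite (leq_trans (size_scale_leq _ _)) ?(leq_trans (size_binp _)).
  apply/eqP; apply: (@roots_geq_poly_eq0 _ _ [seq j%:R | j <- iota 0 (size P)]).
  - apply/allP => x /mapP[j]; rewrite mem_iota add0n => /andP[_ jP] ->.
    by rewrite /root hornerD hornerN Hc // subrr.
  - by rewrite map_inj_uniq ?iota_uniq // => i j /eqP; rewrite eqr_nat => /eqP.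
  - by rewrite size_map size_iota.
move=> m; elim: m => [|m [c Hc]]; first by exists (fun=> 0).
have /intrP[z Hz] : P.[m%:R] - (\sum_(b < m) (c b)%:~R *: binp b).[m%:R] \is a Num.int.
  rewrite rpredB //; first exact: (IP m%:Z).
  rewrite horner_sum rpred_sum // => b _; rewrite hornerZ.
  by apply: rpredM; [exact: intr_int | exact: (IV_binp b m%:Z)].
exists (fun b => if b == m then z else c b) => j jm.
rewrite big_ord_recr /= eqxx hornerD hornerZ -Hz.
have -> : \sum_(b < m) (if (b : nat) == m then z else c b)%:~R *: binp b
       = \sum_(b < m) (c b)%:~R *: binp b.
  by apply: eq_bigr => b _; rewrite ltn_eqF.
move: jm; rewrite ltnS leq_eqVlt => /predU1P[->|jm].
  by rewrite binp_diag mulr1 addrC subrK.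
by rewrite binp_root // mulr0 addr0 Hc.
Qed.

Let comm_e (P : {poly rat}) : e * phi P = phi (P \Po shift (- 2)) * e.
Proof.
have eh : e * h = phi (shift (- 2)) * e.
  rewrite /shift rmorphD phiX phiC mulrDl -scalerAl mul1r.
  by rewrite mulrNz scaleNr -he /brk opprB addrC subrK.
elim/poly_ind: P => [|P c IH]; first by rewrite comp_poly0 rmorph0 mulr0 mul0r.
rewrite comp_polyD comp_polyM comp_polyX comp_polyC !rmorphD !rmorphM phiX !phiC.
rewrite mulrDr mulrDl mulrA IH -!mulrA eh; congr (_ + _).
by rewrite -scalerAr -scalerAl mulr1 mul1r.
Qed.

Let comm_f (P : {poly rat}) : phi P * f = f * phi (P \Po shift (- 2)).
Proof.
have fh : h * f = f * phi (shift (- 2)).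
  rewrite /shift rmorphD phiX phiC mulrDr -scalerAr mulr1.
  by rewrite mulrNz scaleNr -hf /brk addrC subrK.
elim/poly_ind: P => [|P c IH]; first by rewrite comp_poly0 rmorph0 mulr0 mul0r.
rewrite comp_polyD comp_polyM comp_polyX comp_polyC !rmorphD !rmorphM phiX !phiC.
rewrite mulrDr mulrDl -mulrA fh mulrA IH -!mulrA; congr (_ + _).
by rewrite -scalerAr -scalerAl mulr1 mul1r.
Qed.

Let shift_shift (P : {poly rat}) (m n : int) :
  (P \Po shift m) \Po shift n = P \Po shift (m + n).
Proof.
rewrite -comp_polyA /shift comp_polyD comp_polyX comp_polyC rmorphD polyCD /=.
by rewrite -addrA [n%:~R%:P + _]addrC.
Qed.

Let comm_dive (P : {poly rat}) (n : nat) :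
  divpow e n * phi P = phi (P \Po shift (- (2 * n%:Z))) * divpow e n.
Proof.
rewrite /divpow -scalerAl -scalerAr; congr (_ *: _).
elim: n P => [|n IH] P.
  by rewrite mulr0 oppr0 /shift mulr0z addr0 comp_polyXr !expr0 mul1r mulr1.
rewrite exprSr -mulrA comm_e mulrA IH shift_shift mulrA.
have -> // : - 2 + - (2 * n%:Z) = - (2 * n.+1%:Z) by rewrite intS; ring.
Qed.

Let comm_divf (P : {poly rat}) (n : nat) :
  phi P * divpow f n = divpow f n * phi (P \Po shift (- (2 * n%:Z))).
Proof.
rewrite /divpow -scalerAl -scalerAr; congr (_ *: _).
elim: n P => [|n IH] P.
  by rewrite mulr0 oppr0 /shift mulr0z addr0 comp_polyXr !expr0 mul1r mulr1.
rewrite exprS mulrA comm_f -mulrA IH shift_shift mulrA.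
have -> // : - 2 + - (2 * n%:Z) = - (2 * n.+1%:Z) by rewrite intS; ring.
Qed.

Let divpowS (x : A) (m : nat) : x * divpow x m = m.+1%:R *: divpow x m.+1.
Proof.
rewrite /divpow -scalerAr -exprS scalerA factS natrM invfM mulrA.
by rewrite divff ?pnatr_eq0 // mul1r.
Qed.

Let divpow0 (x : A) : divpow x 0 = 1.
Proof. by rewrite /divpow fact0 invr1 scale1r expr0. Qed.

Let divpowD (x : A) (m n : nat) :
  divpow x m * divpow x n = divpow x (m + n) *+ 'C(m + n, m).
Proof.
have E : (m`!%:R)^-1 / n`!%:R = 'C(m + n, m)%:R / (m + n)`!%:R :> rat.
  rewrite -(@bin_fact (m + n) m) ?leq_addr // addKn !natrM !invfM.
  by rewrite [RHS]mulrA divff ?mul1r // pnatr_eq0 -lt0n bin_gt0 leq_addr.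
by rewrite /divpow -scalerAl -scalerAr -exprD scalerA E -scaler_nat scalerA.
Qed.

(* The divided power f^(a - j), zero when j > a. *)
Let fsub (a j : nat) : A := if (j <= a)%N then divpow f (a - j) else 0.

Let e_divf (n : nat) :
  e * divpow f n.+1 = divpow f n.+1 * e + divpow f n * phi ('X - (n%:R)%:P).
Proof.
elim: n => [|n IH].
  have d1 x : divpow x 1 = x :> A by rewrite /divpow invr1 scale1r expr1.
  by rewrite !d1 divpow0 subr0 phiX mul1r -ef /brk addrC subrK.
have nz : n.+2%:R != 0 :> rat by rewrite pnatr_eq0.
apply: (scalerI nz).
rewrite scalerAr -divpowS mulrA -[e * f](subrK (f * e)) -/(brk e f) ef.
rewrite mulrDl -mulrA IH -phiX comm_divf mulrDr !mulrA !divpowS.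
clear IH; move: (divpow f n.+1) (divpow f n.+2) => D1 D2.
rewrite scalerDr -!scalerAl addrCA; congr (_ + _).
rewrite !scalerAr -mulrDr -!phiZ -rmorphD; congr (_ * phi _).
rewrite /shift comp_polyX -!mul_polyC !rmorph_nat mulrNz rmorphN /=.
by rewrite intrM -pmulrn rmorphM /= !rmorph_nat -!natr1; ring.
Qed.

Let polyext (P Q : {poly rat}) : (forall x, P.[x] = Q.[x]) -> P = Q.
Proof.
move=> PQ; apply/eqP; rewrite -subr_eq0; apply/eqP.
apply: (@roots_geq_poly_eq0 _ _ [seq j%:R | j <- iota 0 (size (P - Q))]).
- by apply/allP => x _; rewrite /root hornerD hornerN PQ subrr.
- by rewrite map_inj_uniq ?iota_uniq // => i j /eqP; rewrite eqr_nat => /eqP.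
- by rewrite size_map size_iota.
Qed.

Let e_fsub (a j : nat) :
  e * fsub a j = fsub a j * e + fsub a j.+1 * phi ('X - (a%:R - j.+1%:R)%:P).
Proof.
rewrite /fsub; case: ltngtP => [ja|ja|->].
- have -> : (a - j)%N = (a - j.+1).+1 by rewrite -subSn.
  by rewrite e_divf natrB.
- by rewrite !(mulr0, mul0r) addr0.
- by rewrite subnn divpow0 !(mulr1, mul1r, mul0r) addr0.
Qed.

Let cb (c a j : nat) : {poly rat} :=
  binp j \Po shift (2 * j%:Z - c%:Z - a%:Z).

Let cbS (c a j : nat) : (j <= c)%N ->
  c.+1%:R *: cb c.+1 a j.+1 =
    (c - j)%:R *: (cb c a j.+1 \Po shift (- 2))
    + ('X - (a%:R - j.+1%:R)%:P) * cb c a j.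
Proof.
move=> jc; apply: polyext => x; rewrite /cb shift_shift /shift.
pose y := x + (2 * j%:Z - c%:Z - a%:Z)%:~R.
have := binpX j y; have := binp_pascal j y.
move: (binp j.+1) (binp j) => b1 b0 Hp HX.
rewrite hornerD hornerM hornerXsubC.
rewrite !(hornerD, hornerZ, horner_comp, hornerX, hornerC).
rewrite natrB //.
have -> : x + (2 * j.+1%:Z - c.+1%:Z - a%:Z)%:~R = y + 1.
  by rewrite /y; ring.
have -> : x + (2 * j.+1%:Z - c%:Z - a%:Z + - 2)%:~R = y.
  by rewrite /y; ring.
rewrite -/y Hp; move: b1.[y] b0.[y] HX => u1 u0 HX.
transitivity ((c%:R - j%:R) * u1 + j.+1%:R * u1 + (c%:R + 1) * u0).
  by rewrite -!natr1; ring.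
have -> : x = y - (2 * j%:R - c%:R - a%:R) by rewrite /y; ring.
by rewrite HX -!natr1; ring.
Qed.

(* Kostant's commutation formula. *)
Let dive_divf (c a : nat) : divpow e c * divpow f a =
  \sum_(j < c.+1) fsub a j * phi (cb c a j) * divpow e (c - j).
Proof.
elim: c => [|c IH].
  rewrite big_ord1 /cb binp0 comp_polyC rmorph1 subnn !divpow0 mul1r !mulr1.
  by rewrite /fsub subn0.
have nz : c.+1%:R != 0 :> rat by rewrite pnatr_eq0.
apply: (scalerI nz); rewrite scalerAl -divpowS -mulrA IH mulr_sumr.
pose T1 (j : nat) := (c.+1 - j)%:R *:
  (fsub a j * phi (cb c a j \Po shift (- 2)) * divpow e (c.+1 - j)).
pose T2 (j : nat) := fsub a j.+1 *
  phi (('X - (a%:R - j.+1%:R)%:P) * cb c a j) * divpow e (c - j).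
transitivity (\sum_(j < c.+1) (T1 j + T2 j)).
  apply: eq_bigr => j _; rewrite !mulrA e_fsub !mulrDl; congr (_ + _).
    rewrite -[_ * e * _]mulrA comm_e /T1 -!mulrA divpowS subSn; last first.
      by rewrite -ltnS.
    by rewrite -!scalerAr.
  by rewrite /T2 rmorphM !mulrA.
rewrite big_split /=.
have -> : \sum_(j < c.+1) T1 j = T1 0 + \sum_(j < c.+1) T1 j.+1.
  transitivity (\sum_(j < c.+2) T1 j).
    by rewrite [RHS]big_ord_recr /= [T1 c.+1]/T1 subnn scale0r addr0.
  by rewrite big_ord_recl.
rewrite -addrA -big_split /= scaler_sumr [RHS]big_ord_recl /=; congr (_ + _).
  by rewrite /T1 /cb !subn0 shift_shift binp0 -polyC1 !comp_polyC.
apply: eq_bigr => j _; rewrite /bump /= add1n /T1 /T2 subSS.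
rewrite [RHS]scalerAl [in RHS]scalerAr -phiZ cbS; last by rewrite -ltnS.
rewrite (rmorphD phi) phiZ [X in _ = X * _]mulrDr [RHS]mulrDl; congr (_ + _).
by rewrite -[fsub _ _ * (_ *: _)]scalerAr -[RHS]scalerAl.
Qed.

Let scale_mid (x y z : A) (n : int) :
  x * ((n%:~R : rat) *: y) * z = (x * y * z) *~ n.
Proof. by rewrite -scalerAr -scalerAl scaler_int. Qed.

Let monP (a c : nat) (P : {poly rat}) : IV P ->
  kostant_form (divpow f a * phi P * divpow e c).
Proof.
move=> /newton[z ->]; rewrite rmorph_sum mulr_sumr mulr_suml.
apply: zspan_sum => b.
rewrite phiZ scale_mid phi_binp.
exact/zspanMz/(zspan_mem kostant_mon (a, b : nat, c)).
Qed.

Let IV_phi_closed (a c a' c' : nat) (P Q : {poly rat}) : IV P -> IV Q ->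
  kostant_form (divpow f a * phi P * divpow e c
                * (divpow f a' * phi Q * divpow e c')).
Proof.
move=> IP IQ.
have -> : divpow f a * phi P * divpow e c * (divpow f a' * phi Q * divpow e c')
  = divpow f a * phi P * (divpow e c * divpow f a') * phi Q * divpow e c'.
  by rewrite !mulrA.
rewrite dive_divf mulr_sumr 2!mulr_suml.
apply: zspan_sum => j; rewrite /fsub; case: leqP => ja; last first.
  by rewrite !(mul0r, mulr0); exact: zspan0.
set cbj := cb _ _ _; have Icb : IV cbj by apply: IV_shift; exact: IV_binp.
have -> : divpow f a * phi P * (divpow f (a' - j) * phi cbj * divpow e (c - j))
            * phi Q * divpow e c'
  = divpow f a * (phi P * divpow f (a' - j)) * phi cbj
      * (divpow e (c - j) * phi Q) * divpow e c' by rewrite !mulrA.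
rewrite comm_divf comm_dive.
set P' := P \Po _; set Q' := Q \Po _.
have -> : divpow f a * (divpow f (a' - j) * phi P') * phi cbj
            * (phi Q' * divpow e (c - j)) * divpow e c'
  = divpow f a * divpow f (a' - j) * phi (P' * cbj * Q')
      * (divpow e (c - j) * divpow e c') by rewrite !rmorphM !mulrA.
rewrite !divpowD mulrnAr !mulrnAl -mulrnA pmulrn.
by apply/zspanMz/monP/IV_mul; [apply: IV_mul => // |]; apply: IV_shift.
Qed.

Lemma kostant_form_mul (x y : A) :
  kostant_form x -> kostant_form y -> kostant_form (x * y).
Proof.
move=> [s ->] [t ->]; rewrite mulr_suml; apply: zspan_sum => -[m u] /=.
rewrite mulr_sumr; apply: zspan_sum => -[n v] /=.
rewrite mulrzAr mulrzAl -mulrzA /kostant_mon -!phi_binp.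
exact/zspanMz/IV_phi_closed.
Qed.

Lemma kostant_form_divf (m : nat) : kostant_form (divpow f m).
Proof.
have := zspan_mem kostant_mon (m, 0%N, 0%N).
by rewrite /kostant_mon /= -phi_binp binp0 rmorph1 divpow0 !mulr1.
Qed.

Lemma kostant_form_dive (m : nat) : kostant_form (divpow e m).
Proof.
have := zspan_mem kostant_mon (0%N, 0%N, m).
by rewrite /kostant_mon /= -phi_binp binp0 rmorph1 divpow0 !mul1r.
Qed.

End Kostant.

(* Every F_p-split maximal torus of SL_2 is T = g D g^-1 for some g in GL_2(F_p),
   with D the diagonal torus; this is Lie(T), the matrices g diag(a, -a) g^-1. *)
Definition torus_Lie (p : nat) (g : 'M['F_p]_2) (x : sl2 'F_p) : Prop :=
  exists a : 'F_p,
    sl2_mx x = g *m diag_mx (\row_(j < 2) ((-1) ^+ j * a)) *m invmx g.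

(* X has entries in Z_(p), and x is its reduction mod p. Every standard basis
   of sl_2(F_p) is conjugate under GL_2(F_p) to the usual one, so it lifts in
   this sense to a standard basis (E, F, H) of sl_2(Q): conjugate the usual one
   by a lift to GL_2(Z_(p)). Over Z_(p), the elements F^(a) binom(H, b) E^(c)
   span Dist((SL_2)_Z) localized at p, whichever the lift, so that distZ and
   dist below, built from (E, F, H), have Dist(SL_2) over F_p as reduction, and
   E^m / m!, F^m / m! reduce to the divided powers of e and f. *)
Definition sl2_lift (p : nat) (x : sl2 'F_p) (X : sl2 rat) : Prop :=
  forall i j, coprime p `|denq (sl2_mx X i j)|
              /\ ratr (sl2_mx X i j) = sl2_mx x i j.

Section Dist.
Variables (e f h : sl2 rat) (std : sl2_std_basis e f h).
Local Notation U := (env (@sl2_brk rat)).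
Local Notation ue := (env_in (@sl2_brk rat) e).
Local Notation uf := (env_in (@sl2_brk rat) f).
Local Notation uh := (env_in (@sl2_brk rat) h).

Lemma env_he : brk uh ue = 2%:R *: ue.
Proof. by rewrite env_in_brk; case: std => -> _ _ _; rewrite env_inZ. Qed.

Lemma env_hf : brk uh uf = - (2%:R *: uf).
Proof.
rewrite env_in_brk; case: std => _ -> _ _.
by rewrite -scaleNr env_inZ scaleNr.
Qed.

Lemma env_ef : brk ue uf = uh.
Proof. by rewrite env_in_brk; case: std => _ _ -> _. Qed.

(* The proof of sl2_std_basis is an argument because closure under products,
   hence the ring structure below, depends on it. *)
Definition in_distZ of sl2_std_basis e f h : {pred U} :=
  [pred x | `[< kostant_form ue uf uh x >]].

Local Notation S := (in_distZ std).

Lemma in_distZ_subring : subring_closed S.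
Proof.
split.
- apply/asboolP; have := kostant_form_dive ue uf uh 0.
  by rewrite /divpow fact0 invr1 scale1r expr0.
- move=> x y /asboolP Sx /asboolP Sy; apply/asboolP.
  by apply: zspanD => //; exact: zspanN.
- move=> x y /asboolP Sx /asboolP Sy; apply/asboolP.
  exact: (kostant_form_mul env_he env_hf env_ef).
Qed.
HB.instance Definition _ := GRing.isSubringClosed.Build U S in_distZ_subring.

(* Dist((SL_2)_Z), inside U(sl_2(Q)). *)
Record distZ : Type := DistZ { distZ_val : U; _ : distZ_val \in S }.
HB.instance Definition _ := [isSub for distZ_val].
HB.instance Definition _ := [Choice of distZ by <:].
HB.instance Definition _ := [SubChoice_isSubNzRing of distZ by <:].

Lemma distZ_divpow_e (m : nat) : divpow ue m \in S.
Proof. apply/asboolP; exact: kostant_form_dive. Qed.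

Lemma distZ_divpow_f (m : nat) : divpow uf m \in S.
Proof. apply/asboolP; exact: kostant_form_divf. Qed.

Lemma distZ_counit (x : distZ) : env_counit (distZ_val x) \is a Num.int.
Proof.
have divint (y : sl2 rat) m :
    env_counit (divpow (env_in (@sl2_brk rat) y) m) \is a Num.int.
  rewrite /divpow env_counitZ rmorphXn /= env_counit_in expr0n.
  by case: m => [|m]; rewrite ?mulr0 // fact0 invr1 mul1r.
have binint m : env_counit (binomA uh m) \is a Num.int.
  rewrite /binomA env_counitZ rmorph_prod /=; case: m => [|m].
    by rewrite big_ord0 fact0 invr1 mul1r.
  by rewrite big_ord_recl subr0 env_counit_in mul0r mulr0.
case: x => x /= /asboolP[s ->]; rewrite rmorph_sum rpred_sum // => -[n t] _ /=.
rewrite rmorphMz /= rpredMz // /kostant_mon !rmorphM /=.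
by apply: rpredM => //; apply: rpredM.
Qed.

Variables (p : nat) (p_pr : prime p).

Definition in_pdistZ of prime p : {pred distZ} :=
  [pred x | `[< exists y : distZ, x = y *+ p >]].

Lemma in_pdistZ_idealr : idealr_closed (in_pdistZ p_pr).
Proof.
split.
- by apply/asboolP; exists 0; rewrite mul0rn.
- apply/negP => /asboolP[y /(congr1 (fun x => env_counit (distZ_val x)))].
  have -> : distZ_val 1 = 1 by [].
  have -> : distZ_val (y *+ p) = distZ_val y *+ p by exact: (raddfMn \val).
  rewrite rmorph1 rmorphMn /=.
  have /intrP[n ->] := distZ_counit y.
  rewrite -mulr_natr pmulrn -intrM -[1]/(1%:~R) => /eqP; rewrite eqr_int.
  move=> /eqP/(congr1 absz); rewrite abszM => /esym/eqP.
  rewrite muln_eq1 => /andP[_ /eqP p1].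
  by have := p_pr; rewrite (p1 : p = 1%N).
- move=> a x y /asboolP[x' ->] /asboolP[y' ->]; apply/asboolP.
  by exists (a * x' + y'); rewrite mulrnDl mulrnAr.
Qed.
HB.instance Definition _ :=
  isIdealr.Build distZ (in_pdistZ p_pr) in_pdistZ_idealr.

Lemma in_pdistZ_right :
  forall a, {in in_pdistZ p_pr, forall u, u * a \in in_pdistZ p_pr}.
Proof.
move=> a u /asboolP[x ->]; apply/asboolP; exists (x * a).
by rewrite mulrnAl.
Qed.
HB.instance Definition _ :=
  isRightStable.Build distZ (in_pdistZ p_pr) in_pdistZ_right.

Local Notation distmod := (quot2 (in_pdistZ p_pr)).

Lemma distmod_pchar : p \in [pchar distmod].
Proof.
rewrite inE p_pr /= -(rmorph_nat (to_quot2 (in_pdistZ p_pr))).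
apply/eqP; rewrite -(raddf0 (to_quot2 (in_pdistZ p_pr))).
by apply/to_quot2_eq; rewrite subr0; apply/asboolP; exists 1.
Qed.

(* Dist((SL_2)_Z) tensored with F_p, as a quotient by p; pPrimeCharType makes
   a ring of characteristic p an 'F_p-algebra. *)
Definition dist : Type := pPrimeCharType distmod_pchar.
HB.instance Definition _ := GRing.Algebra.on dist.

Definition dist_red (x : distZ) : dist := to_quot2 (in_pdistZ p_pr) x.

Definition dist_e (m : nat) : dist := dist_red (DistZ (distZ_divpow_e m)).
Definition dist_f (m : nat) : dist := dist_red (DistZ (distZ_divpow_f m)).

End Dist.

(* The relations between e k = e^(p^k) and f k = f^(p^k). *)
Inductive dist_rel (p : nat) (A : nzRingType) (e f : nat -> A) :
    A -> A -> Prop :=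
| rel_Xe k : let X := brk (e k) (f k) in
    dist_rel p e f (brk X (e k)) (e k *+ 2)
| rel_Xf k : let X := brk (e k) (f k) in
    dist_rel p e f (brk X (f k)) (- (f k *+ 2))
| rel_Xe0 k n : (0 < n)%N -> let X := brk (e k) (f k) in
    dist_rel p e f (brk X (e (k + n)%N)) 0
| rel_Xf0 k n : (0 < n)%N -> let X := brk (e k) (f k) in
    dist_rel p e f (brk X (f (k + n)%N)) 0
| rel_ee k n : (0 < n)%N ->
    dist_rel p e f (brk (e k) (e (k + n)%N)) 0
| rel_ff k n : (0 < n)%N ->
    dist_rel p e f (brk (f k) (f (k + n)%N)) 0
| rel_ef k n : (0 < n)%N -> let X := brk (e k) (f k) in
    dist_rel p e f (brk (e k) (f (k + n)%N))
      ((-1) ^+ n * (\prod_(i < n) f (k + i)%N ^+ (p - 1)) * (X + 1))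
| rel_fe k n : (0 < n)%N -> let X := brk (e k) (f k) in
    dist_rel p e f (brk (e (k + n)%N) (f k))
      ((-1) ^+ n * (X + 1) * \prod_(i < n) e (k + i)%N ^+ (p - 1))
| rel_ep k : dist_rel p e f (e k ^+ p) 0
| rel_fp k : dist_rel p e f (f k ^+ p) 0
| rel_Xp k : let X := brk (e k) (f k) in
    dist_rel p e f (X ^+ p) X.

Definition dist_gen (e f h : sl2 rat) (std : sl2_std_basis e f h)
    (p : nat) (p_pr : prime p) (i : nat + nat) : dist std p_pr :=
  match i with
  | inl k => dist_e std p_pr (p ^ k)
  | inr k => dist_f std p_pr (p ^ k)
  end.

Definition free_e (p k : nat) : free_alg 'F_p (nat + nat)%type :=
  free_gen 'F_p (inl k).
Definition free_f (p k : nat) : free_alg 'F_p (nat + nat)%type :=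
  free_gen 'F_p (inr k).

(* Main.v *)
(* (1) Put q = p^k. Modulo p, Kostant's formula for e^(q) f^(q(s+1)) collapses to
         [e^(q), f^(q(s+1))] = f^(qs) (X_k - s)   for all s >= 0,
   because 'C(q(s+1) - j, qs) = 1 for 0 < j <= q and binom(h + qs, j) = binom(h, j)
   for j < q. All the relations follow: s = p^n - 1 gives the brackets of e^(p^k)
   and f^(p^(k+n)), s = 1 gives [X_k, f^(q)] = - 2 f^(q), and applying Kostant's
   formula once more, to the sequence a |-> f^(qa), the vanishing of (e^(q))^p
   gives 0 = (e^(q))^p f^(qp) = X_k (X_k - 1) ... (X_k - p + 1) = X_k^p - X_k.

   (2) Let A_N be the subalgebra generated by e^(p^k), f^(p^k) with k < N. The
   relations make ad e^(p^N) and ad f^(p^N) derivations of A_N into itself, so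
   A_(N+1) is spanned by the A_N f^i X^j e^l with i, j, l < p, where f, X, e are
   the elements of level N. Hence A_N is spanned by p^(3N) explicit monomials,
   in any algebra in which the relations hold.

   (3) In Dist(SL_2), A_N contains the p^(3N) elements f^(a) binom(h, b) e^(c) with
   a, b, c < p^N, which are linearly independent by the PBW theorem for sl_2; PBW
   is obtained from the action on the irreducible modules of all dimensions. So
   the p^(3N) monomials of (2) are linearly independent in Dist(SL_2), and a
   word of the free algebra that vanishes there already vanishes modulo the
   relations. *)
Require Import Defs.
From HB Require Import structures.
From mathcomp Require Import all_boot all_order all_algebra all_field.
From mathcomp Require Import boolp finmap monalg zify ring.

Set Implicit Arguments.
Unset Strict Implicit.
Unset Printing Implicit Defensive.

Import GRing.Theory.
Local Open Scope ring_scope.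

(** * Binomial coefficients modulo p and falling factorials *)

Section BinomialModPrime.
Variables (p : nat) (p_pr : prime p).

(** As [p ^ k] divides [i * 'C(p ^ k, i)], a binomial prime to [p] would make [p ^ k] divide [i],
    which is too small. *)
Lemma dvdn_bin_pfactor (k i : nat) :
  (0 < i < p ^ k)%N -> (p %| 'C(p ^ k, i))%N.
Proof.
move=> /andP[i0 ik]; apply: contraT => pC.
have : (p ^ k %| i * 'C(p ^ k, i))%N.
  case: i i0 ik {pC} => // i _ _; case: (p ^ k)%N => [|q]; first by rewrite bin0n muln0.
  by rewrite -mul_bin_diag dvdn_mulr.
rewrite Gauss_dvdl; first by move=> /(dvdn_leq i0); rewrite leqNgt ik.
by rewrite coprimeXl // prime_coprime.
Qed.

Variables (R : nzRingType) (Rp : p \in [pchar R]).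

Lemma natr_pchar_dvd (n : nat) : (p %| n)%N -> n%:R = 0 :> R.
Proof. by move=> pn; apply/eqP; rewrite -(dvdn_pcharf Rp). Qed.

Variable k : nat.
Local Notation q := (p ^ k)%N.

(** This lemma and the next two are cases of Lucas's congruence. Each comes from Vandermonde's
    convolution, where all terms but the extreme ones vanish modulo [p]. *)
Lemma bin_pfactor_lt (s i : nat) :
  (i < q)%N -> 'C(q * s, i)%:R = (i == 0%N)%:R :> R.
Proof.
elim: s i => [|s IH] i iq; first by rewrite muln0 bin0n.
rewrite mulnS -binomial.Vandermonde natr_sum (bigD1 (Ordinal (ltn0Sn i))) //=.
rewrite big1 ?bin0 ?mul1n ?subn0 ?addr0 ?IH // => -[j ji] /=.
rewrite -val_eqE /= => j0; rewrite natrM natr_pchar_dvd ?mul0r //.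
by apply: dvdn_bin_pfactor; lia.
Qed.

Lemma bin_pfactor (s : nat) : 'C(q * s, q)%:R = s%:R :> R.
Proof.
elim: s => [|s IH]; first by rewrite muln0 bin0n eqn0Ngt expn_gt0 prime_gt0.
have q0 : (0 < q)%N by rewrite expn_gt0 prime_gt0.
rewrite mulnS -binomial.Vandermonde natr_sum big_ord_recr (bigD1 (Ordinal q0)) //=.
rewrite bin0 subn0 subnn bin0 binn mul1n muln1 IH big1 ?addr0 -?natr1; last first.
  move=> [i iq] /=; rewrite -val_eqE /= => i0; rewrite natrM natr_pchar_dvd ?mul0r //.
  by apply: dvdn_bin_pfactor; lia.
by rewrite -?[s.+1%:R]natr1 ?add0r addrC.
Qed.

Lemma bin_pfactor_add (s m : nat) :
  (m < q)%N -> 'C(q * s + m, m)%:R = 1 :> R.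
Proof.
move=> mq; rewrite -binomial.Vandermonde natr_sum (bigD1 (Ordinal (ltn0Sn m))) //=.
rewrite bin0 subn0 binn mul1n big1 ?addr0 // => -[j jm] /=.
rewrite -val_eqE /= => j0; rewrite natrM bin_pfactor_lt; last by lia.
by rewrite (negPf j0) mul0r.
Qed.

End BinomialModPrime.

(** The numerator of a binomial coefficient, free of division so that it makes sense in
    characteristic [p]. *)
Definition ffactr (R : nzRingType) (x : R) (n : nat) : R :=
  \prod_(i < n) (x - (i : nat)%:R).

Lemma ffactr0 (R : nzRingType) (x : R) : ffactr x 0 = 1.
Proof. exact: big_ord0. Qed.

Lemma ffactrS (R : nzRingType) (x : R) (n : nat) :
  ffactr x n.+1 = ffactr x n * (x - n%:R).
Proof. exact: big_ord_recr. Qed.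

Lemma rmorph_ffactr (R S : nzRingType) (g : {rmorphism R -> S}) (x : R) n :
  g (ffactr x n) = ffactr (g x) n.
Proof.
by rewrite rmorph_prod; apply: eq_bigr => i _; rewrite rmorphB rmorph_nat.
Qed.

Lemma ffactr_addr1 (R : comNzRingType) (x : R) (n : nat) :
  ffactr (x + 1) n.+1 = ffactr x n.+1 + n.+1%:R * ffactr x n.
Proof.
elim: n => [|n IH]; first by rewrite !ffactrS !ffactr0; ring.
rewrite [LHS]ffactrS IH [ffactr x n.+2]ffactrS ffactrS -!natr1; ring.
Qed.

(** The coefficient identity behind the induction on [c] in [mul_exp_divided]. Besides Pascal's
    rules it uses [(c + 1) 'C(c, j) = (j + 1) 'C(c + 1, j + 1)]. *)
Lemma ffactr_bin_rec (R : comNzRingType) (y : R) (c j : nat) :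
  ffactr y j.+1 *+ 'C(c, j.+1) + (y - j%:R + c.+1%:R) * ffactr y j *+ 'C(c, j)
  = ffactr (y + 1) j.+1 *+ 'C(c.+1, j.+1).
Proof.
have E : c.+1%:R * 'C(c, j)%:R = j.+1%:R * ('C(c, j.+1)%:R + 'C(c, j)%:R) :> R.
  by rewrite -natrD -binS -!natrM mul_bin_diag.
rewrite ffactr_addr1 ffactrS binS mulrnDr.
move: {E} (ffactr y j) (y - j%:R) 'C(c, j) 'C(c, j.+1) c.+1%:R j.+1%:R E.
move=> G z b0 b1 c1 j1 E.
transitivity (G * z *+ b1 + z * G *+ b0 + c1 * b0%:R * G); first by ring.
by rewrite E; ring.
Qed.

(** * Commuting powers of e past a sequence of divided powers *)

Section CommutePowers.
Variables (R : nzRingType) (e h : R) (d : nat -> R) (N : nat).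
Hypotheses (he : brk h e = e *+ 2) (ed0 : e * d 0 = d 0 * e).
Hypothesis edS : forall a, (a < N)%N ->
  e * d a.+1 = d a.+1 * e + d a * (h - a%:R).

Fact commr_int_rmorph : commr_rmorph (intr : int -> R) h.
Proof. by move=> n; apply: commr_int. Qed.

(** Polynomials in [h] are computed in the commutative ring [{poly int}], where [ring] applies, and
    then evaluated at [h]. *)
Let phi : {rmorphism {poly int} -> R} := horner_morph commr_int_rmorph.
Let phiX : phi 'X = h. Proof. exact: horner_morphX. Qed.
Let shift (n : int) : {poly int} := 'X + n%:~R.

Let phi_shift (n : int) : phi (shift n) = h + n%:~R.
Proof. by rewrite rmorphD phiX rmorph_int. Qed.

Let e_phi (n : int) : e * phi (shift n) = phi (shift (n - 2)) * e.
Proof.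
rewrite !phi_shift mulrDr mulrDl commr_int rmorphB mulrBl addrA addrAC.
congr (_ + _); apply: (addIr (e *+ 2)).
by rewrite -{1}he /brk addrCA subrr addr0 mulr_natl subrK.
Qed.

Let e_ffactr (n : int) (j : nat) :
  e * phi (ffactr (shift n) j) = phi (ffactr (shift (n - 2)) j) * e.
Proof.
elim: j => [|j IH]; first by rewrite !ffactr0 rmorph1 mul1r mulr1.
have shE m : shift m - j%:R = shift (m - j%:Z) by rewrite /shift rmorphB addrA.
rewrite !ffactrS !rmorphM mulrA IH -!mulrA !shE e_phi; congr (_ * (phi _ * _)).
by rewrite addrAC.
Qed.

(* Only the commutator of e with d matters, so the formula applies both to the
   rational divided powers d a = f^a / a! and, modulo p, to d a = f^(p^k a),
   where h is replaced by X_k. *)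
Lemma mul_exp_divided (c a : nat) : (a <= N)%N ->
  e ^+ c * d a = \sum_(j < c.+1)
    if (j <= a)%N then
      d (a - j)%N * ffactr (h + (2 * j%:Z - c%:Z - a%:Z)%:~R) j * e ^+ (c - j)
        *+ 'C(c, j)
    else 0.
Proof.
move=> aN.
(* Extending by 0 beyond [a] lets [eD] hold for every [j]; at [j = a] it reduces to [ed0]. *)
pose D j := if (j <= a)%N then d (a - j)%N else 0.
have eD j : e * D j = D j * e + D j.+1 * phi (shift (j.+1%:Z - a%:Z)).
  rewrite /D; case: ltngtP => [ja|ja|->].
  - have -> : (a - j)%N = (a - j.+1).+1 by lia.
    rewrite edS; last by lia.
    rewrite phi_shift; congr (_ + _ * (_ + _)).
    by rewrite natrB // opprB rmorphB.
  - by rewrite mulr0 !mul0r addr0.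
  - by rewrite subnn mul0r addr0.
pose T c j := D j * phi (ffactr (shift (2 * j%:Z - c%:Z - a%:Z)) j *+ 'C(c, j))
                * e ^+ (c - j).
suff -> : e ^+ c * d a = \sum_(j < c.+1) T c j.
  apply: eq_bigr => j _; rewrite /T /D; case: ifP => _; last by rewrite !mul0r.
  by rewrite rmorphMn rmorph_ffactr phi_shift mulrnAr mulrnAl.
elim: c => [|c IH]; first by rewrite big_ord1 /T /D subn0 ffactr0 rmorph1 !mulr1 mul1r.
rewrite exprS -mulrA IH mulr_sumr.
(* [T1] comes from moving [e] past [D j], [T2] from the commutator. The terms [T1 j.+1] and [T2 j]
   have the same outer factors, and [ffactr_bin_rec] adds the middle ones. *)
pose T1 j := D j * phi (ffactr (shift (2 * j%:Z - c%:Z - a%:Z - 2)) j *+ 'C(c, j))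
                * e ^+ (c.+1 - j).
pose T2 j := D j.+1 * phi (shift (j.+1%:Z - a%:Z)
    * ffactr (shift (2 * j%:Z - c%:Z - a%:Z)) j *+ 'C(c, j)) * e ^+ (c - j).
transitivity (\sum_(j < c.+1) (T1 j + T2 j)).
  apply: eq_bigr => j _; rewrite /T !mulrA eD [(_ + _ * _) * phi _]mulrDl [LHS]mulrDl;
    congr (_ + _).
    rewrite -[_ * e * _]mulrA /T1 !rmorphMn mulrnAr e_ffactr -mulrnAl -!mulrA -exprS.
    by rewrite subSn // -ltnS.
  by rewrite /T2 -mulrnAr rmorphM !mulrA.
rewrite big_split /=.
have -> : \sum_(j < c.+1) T1 j = T1 0 + \sum_(j < c.+1) T1 j.+1.
  transitivity (\sum_(j < c.+2) T1 j); last by rewrite big_ord_recl.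
  by rewrite [RHS]big_ord_recr /= [T1 c.+1]/T1 bin_small // mulr0n rmorph0 mulr0 mul0r
    addr0.
rewrite -addrA -big_split /= [RHS]big_ord_recl /=; congr (_ + _).
  by rewrite /T1 /T !ffactr0 !bin0.
apply: eq_bigr => j _; rewrite /bump /= add1n /T1 /T2 /T subSS -mulrDl -mulrDr.
congr (_ * _ * _); rewrite -rmorphD; congr (phi _).
set y := shift (2 * j.+1%:Z - c%:Z - a%:Z - 2).
have -> : shift (2 * j.+1%:Z - c.+1%:Z - a%:Z) = y + 1 by rewrite /y /shift; ring.
have -> : shift (2 * j%:Z - c%:Z - a%:Z) = y by rewrite /y /shift; ring.
have -> : shift (j.+1%:Z - a%:Z) = y - j%:R + (c.+1%:R) by rewrite /y /shift -!natr1;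
  ring.
exact: ffactr_bin_rec.
Qed.

End CommutePowers.

(** * Divided powers in characteristic p *)

Section Brackets.
Variable R : nzRingType.
Implicit Types x y z : R.

Lemma brkC x y : brk y x = - brk x y.
Proof. by rewrite /brk opprB. Qed.

Lemma brkBl x y z : brk (x - y) z = brk x z - brk y z.
Proof. by rewrite /brk mulrBr mulrBl !opprB addrACA [RHS]addrACA [- (y * z) - _]addrC.
  Qed.

Lemma brkMr x y z : brk x (y * z) = brk x y * z + y * brk x z.
Proof. by rewrite /brk mulrBl mulrBr !mulrA subrKA. Qed.

Lemma brkMl x y z : brk (x * y) z = x * brk y z + brk x z * y.
Proof. by rewrite /brk mulrBl mulrBr !mulrA subrKA. Qed.

Lemma brk_brkl x y z : brk (brk x y) z = brk (brk x z) y + brk x (brk y z).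
Proof.
by rewrite [brk x y]/brk brkBl !brkMl [X in X - _]addrC opprD addrACA.
Qed.

End Brackets.

Lemma rmorph_brk (A B : nzRingType) (g : {rmorphism A -> B}) (x y : A) :
  g (brk x y) = brk (g x) (g y).
Proof. by rewrite rmorphB !rmorphM. Qed.

Lemma bin_addC (m n : nat) : 'C(m + n, m) = 'C(m + n, n).
Proof. by rewrite -[RHS]bin_sub ?leq_addl // addnK. Qed.

Section DividedPowerSequence.
Variables (p : nat) (p_pr : prime p) (A : nzRingType) (Ap : p \in [pchar A]).
Variable x : nat -> A.
Hypothesis x0 : x 0 = 1.
Hypothesis xM : forall m n, x m * x n = x (m + n)%N *+ 'C(m + n, m).

Lemma divpow_mul_lt (k s m : nat) : (m < p ^ k)%N ->
  x (p ^ k * s) * x m = x (p ^ k * s + m)%N.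
Proof.
move=> mq; rewrite xM bin_addC.
by rewrite -mulr_natr (bin_pfactor_add p_pr Ap) // mulr1.
Qed.

Lemma divpow_mul_pfactor (k m : nat) :
  x (p ^ k * m)%N * x (p ^ k) = x (p ^ k * m.+1)%N *+ m.+1.
Proof.
rewrite xM bin_addC -mulr_natr addnC -mulnS.
by rewrite (bin_pfactor p_pr Ap) mulr_natr.
Qed.

Lemma divpow_exp (k m : nat) : x (p ^ k) ^+ m = x (p ^ k * m)%N *+ m`!.
Proof.
elim: m => [|m IH]; first by rewrite muln0 x0.
by rewrite exprSr IH mulrnAl divpow_mul_pfactor -mulrnA.
Qed.

Lemma divpow_exp_p (k : nat) : x (p ^ k) ^+ p = 0.
Proof.
rewrite divpow_exp -mulr_natr (natr_pchar_dvd Ap) ?mulr0 //.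
by rewrite dvdn_fact ?prime_gt0 ?leqnn.
Qed.

Lemma divpow_comm (m n : nat) : brk (x m) (x n) = 0.
Proof. by rewrite /brk !xM bin_addC [(n + m)%N]addnC subrr. Qed.

(** By Wilson's theorem [(p - 1)!] is -1 modulo [p]. *)
Lemma divpow_exp_pred (k : nat) : x (p ^ k) ^+ (p - 1) = - x (p ^ k * (p - 1))%N.
Proof.
rewrite divpow_exp.
have W : (p - 1)`!%:R = -1 :> A.
  apply/eqP; rewrite -addr_eq0 natr1 (natr_pchar_dvd Ap) // subn1.
  by rewrite -Wilson ?prime_gt1.
by rewrite -mulr_natr W mulrN1.
Qed.

(** All [n] digits of [p ^ n - 1] in base [p] equal [p - 1]. The divided power splits along them by
    [divpow_mul_lt], and each factor contributes a sign by [divpow_exp_pred]. *)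
Lemma divpow_pfactor_pred (k n : nat) :
  x (p ^ k * (p ^ n).-1) = (-1) ^+ n * \prod_(i < n) x (p ^ (k + i)) ^+ (p - 1).
Proof.
elim: n => [|n IH]; first by rewrite muln0 x0 big_ord0 mul1r.
have p0 := prime_gt0 p_pr; have pn : (0 < p ^ n)%N by rewrite expn_gt0 p0.
have -> : (p ^ k * (p ^ n.+1).-1 = p ^ (k + n) * (p - 1) + p ^ k * (p ^ n).-1)%N.
  rewrite expnD expnSr -mulnA -mulnDr; congr (_ * _)%N.
  by case: (p ^ n)%N pn => // r _; case: p p0 => // p' _; lia.
rewrite -divpow_mul_lt; last first.
  by rewrite expnD ltn_pmul2l ?prednK // expn_gt0 p0.
(* [divpow_mul_lt] puts the top digit on the left, whereas the product ends with it. *)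
have /eqP := divpow_comm (p ^ (k + n) * (p - 1)) (p ^ k * (p ^ n).-1).
rewrite subr_eq0 => /eqP ->; rewrite IH -[x (p ^ (k + n) * _)]opprK -divpow_exp_pred.
by rewrite big_ord_recr /= exprS mulN1r mulrN mulNr mulrA.
Qed.

End DividedPowerSequence.

(* [B m j] plays the role of the binomial coefficient binom(h + m, j). *)
Record divided_powers (A : nzRingType) (ed fd : nat -> A) (B : int -> nat -> A) :
    Prop := DividedPowers {
  dp_e0 : ed 0 = 1;
  dp_f0 : fd 0 = 1;
  dp_ee : forall m n, ed m * ed n = ed (m + n)%N *+ 'C(m + n, m);
  dp_ff : forall m n, fd m * fd n = fd (m + n)%N *+ 'C(m + n, m);
  dp_B0 : forall m, B m 0 = 1;
  dp_BS : forall m j, B (m + 1) j.+1 = B m j.+1 + B m j;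
  dp_ef : forall c a, ed c * fd a = \sum_(j < (minn a c).+1)
    fd (a - j)%N * B (2 * j%:Z - c%:Z - a%:Z) j * ed (c - j)%N
}.

(* This symmetry transports to e the relations proved for f. *)
Lemma divided_powers_converse (A : nzRingType) (ed fd : nat -> A) B :
  divided_powers ed fd B -> @divided_powers A^c fd ed B.
Proof.
case=> e0 f0 ee ff B0 BS ef; split=> // [m n|m n|c a].
- by rewrite addnC -bin_addC; exact: ff.
- by rewrite addnC -bin_addC; exact: ee.
transitivity (ed a * fd c) => //; rewrite ef minnC; apply: eq_bigr => j _.
by rewrite -[in LHS]mulrA addrAC.
Qed.

Section DividedPowersModP.
Variables (p : nat) (p_pr : prime p) (A : nzRingType) (Ap : p \in [pchar A]).
Variables (ed fd : nat -> A) (B : int -> nat -> A).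
Hypothesis dp : divided_powers ed fd B.

(** Vandermonde's convolution for the abstract [B], obtained by iterating Pascal's rule [dp_BS]. *)
Lemma dp_vandermonde (m : int) (n j : nat) :
  B (m + n%:Z) j = \sum_(i < j.+1) B m (j - i)%N *+ 'C(n, i).
Proof.
elim: n j => [|n IH] j.
  rewrite addr0 big_ord_recl bin0 subn0 big1 ?addr0 //.
case: j => [|j]; first by rewrite big_ord1 !(dp_B0 dp).
have -> : m + n.+1%:Z = m + n%:Z + 1 by rewrite -addrA intS [1 + _]addrC.
rewrite (dp_BS dp) !IH [in LHS]big_ord_recl [RHS]big_ord_recl !bin0 -addrA.
congr (_ + _); rewrite -big_split /=; apply: eq_bigr => i _.
by rewrite /bump /= add1n subSS binS mulrnDr.
Qed.

Variable k : nat.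
Local Notation q := (p ^ k)%N.
Local Notation X := (brk (ed q) (fd q)).

Let q_gt0 : (0 < q)%N. Proof. by rewrite expn_gt0 prime_gt0. Qed.

(** Modulo [p], the coefficient ['C(q * s, i)] of [dp_vandermonde] is 1 at [i = 0], [s] at [i = q]
    and 0 in between. *)
Lemma dp_B_period (m : int) (s j : nat) : (j <= q)%N ->
  B (m + (q * s)%:Z) j = B m j + (s *+ (j == q))%:R.
Proof.
move=> jq; rewrite dp_vandermonde.
have binA i : (i <= q)%N -> 'C(q * s, i)%:R = (i == 0%N)%:R + (s *+ (i == q))%:R :> A.
  rewrite leq_eqVlt => /predU1P[->|iq]; last first.
    by rewrite (bin_pfactor_lt p_pr Ap s iq) (ltn_eqF iq) addr0.
  by rewrite (bin_pfactor p_pr Ap) eqxx eqn0Ngt q_gt0 add0r.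
rewrite big_ord_recl bin0 subn0; congr (_ + _).
transitivity (\sum_(i < j) B m (j - i.+1)%N * (s *+ (i.+1 == q))%:R).
  apply: eq_bigr => i _; rewrite lift0 -[LHS]mulr_natr binA ?add0r //.
  exact: leq_trans (ltn_ord i) jq.
case: j jq => [|j] jq; first by rewrite big_ord0 ltn_eqF.
rewrite big_ord_recr /= subnn (dp_B0 dp) mul1r big1 ?add0r // => i _.
have -> : (i.+1 == q) = false by apply/ltn_eqF/(leq_trans _ jq); rewrite ltnS.
by rewrite mulr0.
Qed.

(** The terms of Kostant's formula for [fd (q * s.+1)] are those for [fd q] multiplied on the left
    by [fd (q * s)], except that by [dp_B_period] the factor [B] of the last one is smaller by
    [s]. *)
Lemma dp_brk_e_f (s : nat) :
  brk (ed q) (fd (q * s.+1)%N) = fd (q * s)%N * (X - s%:R).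
Proof.
(* The term [j = 0] of Kostant's formula is [fd a * ed q], which the bracket cancels. *)
have brkE a : (q <= a)%N -> brk (ed q) (fd a) = \sum_(j < q)
    fd (a - j.+1)%N * B (2 * j.+1%:Z - q%:Z - a%:Z) j.+1 * ed (q - j.+1)%N.
  move=> qa; rewrite /brk (dp_ef dp) (minn_idPr qa) big_ord_recl !subn0 (dp_B0 dp).
  by rewrite mulr1 addrC addKr.
rewrite !brkE ?leq_pmulr //.
(* Writing [s] as a sum concentrated at the last index makes the comparison termwise. *)
have -> : s%:R = \sum_(j < q) (s *+ (j.+1 == q))%:R :> A.
  case: q q_gt0 => // r _; rewrite big_ord_recr /= eqxx big1 ?add0r // => i _.
  by rewrite eqSS ltn_eqF.
rewrite -sumrB mulr_sumr; apply: eq_bigr => j _.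
have jq := ltn_ord j.
have -> : 2 * j.+1%:Z - q%:Z - q%:Z = 2 * j.+1%:Z - q%:Z - (q * s.+1)%:Z + (q * s)%:Z.
  by rewrite mulnS PoszD; ring.
rewrite dp_B_period // [fd (q - _)%N * (_ + _)]mulrDr [(_ + _) * ed _]mulrDl.
have -> : fd (q - j.+1)%N * (s *+ (j.+1 == q))%:R * ed (q - j.+1)%N =
  (s *+ (j.+1 == q))%:R.
  have [->|_] := eqVneq; last by rewrite mulr0 mul0r.
  by rewrite subnn (dp_e0 dp) (dp_f0 dp) mul1r mulr1.
rewrite addrK !mulrA (divpow_mul_lt p_pr Ap (dp_ff dp)); last by lia.
by congr (fd _ * _ * _); rewrite mulnS; lia.
Qed.

(* Compute [e^(q), (f^(q))^2] = [e^(q), 2 f^(2q)] in two ways. *)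
Lemma dp_brk_X_f : brk X (fd q) = - (fd q *+ 2).
Proof.
have F2 := divpow_mul_pfactor p_pr Ap (dp_ff dp) k 1; rewrite muln1 in F2.
have : brk (ed q) (fd q * fd q) = fd q * (X - 1) *+ 2.
  rewrite F2 {1}/brk mulrnAr mulrnAl -mulrnBl -/(brk _ _) dp_brk_e_f.
  by rewrite muln1.
rewrite brkMr => H; rewrite {1}/brk -[X in X - _](addrK (fd q * X)) H.
by rewrite mulrBr mulr1 mulrnBl -addrA -opprD -mulr2n addrAC subrr add0r.
Qed.

(** By the Jacobi identity, as the two powers of [f] commute, the bracket is that of
    [fd (q * s) * (X - s)] with [fd q], where only [brk X (fd q)] survives. *)
Lemma dp_brk_X_f_mul (s : nat) :
  brk X (fd (q * s.+1)%N) = - (fd (q * s.+1)%N *+ (2 * s.+1)).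
Proof.
rewrite brk_brkl (divpow_comm (dp_ff dp)) [brk (ed q) 0]/brk mulr0 mul0r subrr addr0.
rewrite dp_brk_e_f brkMl (divpow_comm (dp_ff dp)) mul0r addr0 brkBl dp_brk_X_f.
have -> : brk s%:R (fd q) = 0 by rewrite /brk commr_nat subrr.
by rewrite subr0 mulrN mulrnAr (divpow_mul_pfactor p_pr Ap (dp_ff dp)) -mulrnA [(2 *
  _)%N]mulnC.
Qed.

End DividedPowersModP.

(** * The defining relations in characteristic p *)

Section FRelations.
Variables (p : nat) (p_pr : prime p) (A : nzRingType) (Ap : p \in [pchar A]).
Variables (ed fd : nat -> A) (B : int -> nat -> A).
Hypothesis dp : divided_powers ed fd B.

(** Turns the factor [X - s] of [dp_brk_e_f], at [s = p ^ n - 1], into the [X + 1] of the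
    relations. *)
Lemma dp_sub_pred_pfactor (n : nat) (x : A) : (0 < n)%N ->
  x - (p ^ n).-1%:R = x + 1.
Proof.
move=> n0; have pn : (0 < p ^ n)%N by rewrite expn_gt0 prime_gt0.
have : (p ^ n)%:R = 0 :> A by rewrite (natr_pchar_dvd Ap) ?dvdn_exp.
by rewrite -{1}(prednK pn) -natr1 => /eqP; rewrite addr_eq0 => /eqP ->; rewrite opprK.
Qed.

Lemma dp_brk_e_f_pfactor (k n : nat) : (0 < n)%N ->
  brk (ed (p ^ k)) (fd (p ^ (k + n))) =
    fd (p ^ k * (p ^ n).-1)%N * (brk (ed (p ^ k)) (fd (p ^ k)) + 1).
Proof.
move=> n0; have pn : (0 < p ^ n)%N by rewrite expn_gt0 prime_gt0.
rewrite expnD -{1}(prednK pn) (dp_brk_e_f p_pr Ap dp); congr (_ * _).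
exact: dp_sub_pred_pfactor.
Qed.

(** The factor [2 * p ^ n] given by [dp_brk_X_f_mul] vanishes modulo [p]. *)
Lemma dp_rel_Xf0 (k n : nat) : (0 < n)%N ->
  brk (brk (ed (p ^ k)) (fd (p ^ k))) (fd (p ^ (k + n))) = 0.
Proof.
move=> n0; have pn : (0 < p ^ n)%N by rewrite expn_gt0 prime_gt0.
rewrite expnD -(prednK pn) (dp_brk_X_f_mul p_pr Ap dp) prednK //.
by rewrite -mulr_natr (natr_pchar_dvd Ap) ?mulr0 ?oppr0 // dvdn_mull ?dvdn_exp.
Qed.

End FRelations.

Section Relations.
Variables (p : nat) (p_pr : prime p) (A : algType 'F_p).
Variables (ed fd : nat -> A) (B : int -> nat -> A).
Hypothesis dp : divided_powers ed fd B.

Let Ap : p \in [pchar A]. Proof. by rewrite pchar_lalg pchar_Fp. Qed.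
Let Apc : p \in [pchar A^c]. Proof. exact: Ap. Qed.
Let dpc := divided_powers_converse dp.

(** Evaluation at [x] of the factorization of ['X^p - 'X] over ['F_p], whose roots are all the
    elements of the field. *)
Lemma ffactr_Fp (x : A) : ffactr x p = x ^+ p - x.
Proof.
have E : ffactr 'X p = 'X^p - 'X :> {poly 'F_p}.
  have := finField_genPoly 'F_p; rewrite card_Fp // => ->.
  rewrite (reindex (fun i : 'I_p => i%:R : 'F_p)); last first.
    apply/onW_bij/inj_card_bij; last by rewrite card_Fp // card_ord.
    move=> i j /(congr1 val); rewrite /= !val_Fp_nat // !modn_small // => /val_inj //.
  by apply: eq_bigr => i _; rewrite polyC_natr.
have := congr1 (horner_alg x) E.
by rewrite rmorph_ffactr rmorphB rmorphXn /= !horner_algX.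
Qed.

(* All the terms of e^p * d p with 0 < j < p vanish modulo p, and e^p = 0. *)
Lemma dp_rel_Xp (k : nat) (X := brk (ed (p ^ k)) (fd (p ^ k))) : X ^+ p = X.
Proof.
apply/eqP; rewrite -subr_eq0 -ffactr_Fp; apply/eqP.
have he : brk X (ed (p ^ k)) = ed (p ^ k) *+ 2.
  have := dp_brk_X_f p_pr Apc dpc k => H.
  by rewrite -[brk _ _]opprK -brkC -[RHS]opprK -H.
pose d a := fd (p ^ k * a)%N.
have ed0 : ed (p ^ k) * d 0 = d 0 * ed (p ^ k).
  by rewrite /d muln0 (dp_f0 dp) mulr1 mul1r.
have edS a : (a < p)%N -> ed (p ^ k) * d a.+1 = d a.+1 * ed (p ^ k) + d a * (X - a%:R).
  by move=> _; rewrite /d -(dp_brk_e_f p_pr Ap dp) /brk addrC subrK.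
have := mul_exp_divided he ed0 edS p (leqnn p).
rewrite [ed _ ^+ p](divpow_exp_p p_pr Ap (dp_e0 dp) (dp_ee dp) k) mul0r (bigD1 ord_max)
  //= leqnn.
rewrite subnn binn big1 => [|[j jp]]; last first.
  rewrite -val_eqE /= => jnp; have {jnp} jp : (j < p)%N by lia.
  case: ifP => // _; case: j jp => [|j] jp.
    by rewrite !subn0 [ed _ ^+ p](divpow_exp_p p_pr Ap (dp_e0 dp) (dp_ee dp) k) mulr0
      mul0rn.
  by rewrite -mulr_natr (natr_pchar_dvd Ap) ?mulr0 // prime_dvd_bin.
rewrite /d muln0 (dp_f0 dp) mul1r mulr1 addr0.
have -> : 2 * p%:Z - p%:Z - p%:Z = 0 by ring.
by rewrite mulr0z addr0.
Qed.

(** The mixed relations for [e] are those for [f] read in the opposite ring with [ed] and [fd]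
    exchanged. This leaves [X] fixed and changes the sign of brackets with [X]. *)
Lemma divided_powers_rel (u v : A) :
  dist_rel p (fun k => ed (p ^ k)) (fun k => fd (p ^ k)) u v -> u = v.
Proof.
case=> {u v} [k|k|k n n0|k n n0|k n n0|k n n0|k n n0|k n n0|k|k|k] /=.
- have := dp_brk_X_f p_pr Apc dpc k => H.
  by rewrite -[brk _ _]opprK -brkC -[RHS]opprK -H.
- exact: (dp_brk_X_f p_pr Ap dp).
- have := dp_rel_Xf0 p_pr Apc dpc k n0 => H.
  by rewrite -[brk _ _]opprK -brkC -[RHS]oppr0 -H.
- exact: (dp_rel_Xf0 p_pr Ap dp).
- exact: (divpow_comm (dp_ee dp)).
- exact: (divpow_comm (dp_ff dp)).
- rewrite (dp_brk_e_f_pfactor p_pr Ap dp) //.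
  by rewrite (divpow_pfactor_pred p_pr Ap (dp_f0 dp) (dp_ff dp)).
- have H := dp_brk_e_f_pfactor p_pr Apc dpc k n0.
  transitivity ((brk (ed (p ^ k)) (fd (p ^ k)) + 1) * ed (p ^ k * (p ^ n).-1)%N) => //.
  rewrite (divpow_pfactor_pred p_pr Ap (dp_e0 dp) (dp_ee dp)).
  by rewrite !mulrA; congr (_ * _); exact: commr_sign.
- exact: (divpow_exp_p p_pr Ap (dp_e0 dp) (dp_ee dp) k).
- exact: (divpow_exp_p p_pr Ap (dp_f0 dp) (dp_ff dp) k).
- exact: dp_rel_Xp.
Qed.

End Relations.

(** * Spanning monomials *)

Section LinearSpan.
Variables (K : comNzRingType) (V : lmodType K).

Inductive lspan (P : V -> Prop) : V -> Prop :=
| lspan0 : lspan P 0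
| lspan_cons c x y : P x -> lspan P y -> lspan P (c *: x + y).

Variable P : V -> Prop.

Lemma lspan_mem x : P x -> lspan P x.
Proof. by move=> Px; rewrite -[x]scale1r -[_ *: _]addr0; apply: lspan_cons => //;
  exact: lspan0. Qed.

Lemma lspanD x y : lspan P x -> lspan P y -> lspan P (x + y).
Proof.
move=> Sx Sy; elim: Sx => [|c u v Pu _ IH]; first by rewrite add0r.
by rewrite -addrA; apply: lspan_cons.
Qed.

Lemma lspanZ c x : lspan P x -> lspan P (c *: x).
Proof.
elim=> [|d u v Pu _ IH]; first by rewrite scaler0; exact: lspan0.
by rewrite scalerDr scalerA; apply: lspan_cons.
Qed.

Lemma lspanN x : lspan P x -> lspan P (- x).
Proof. by move=> /(lspanZ (-1)); rewrite scaleN1r. Qed.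

Lemma lspanB x y : lspan P x -> lspan P y -> lspan P (x - y).
Proof. by move=> Sx /lspanN; exact: lspanD. Qed.

Lemma lspanMn x n : lspan P x -> lspan P (x *+ n).
Proof. by move=> /(lspanZ n%:R); rewrite scaler_nat. Qed.

Lemma lspan_sum (I : Type) (r : seq I) (F : I -> V) :
  (forall i, lspan P (F i)) -> lspan P (\sum_(i <- r) F i).
Proof.
move=> PF; elim: r => [|i r IH]; first by rewrite big_nil; exact: lspan0.
by rewrite big_cons; apply: lspanD.
Qed.

End LinearSpan.

Lemma lspan_trans (K : comNzRingType) (V : lmodType K) (P Q : V -> Prop) x :
  (forall y, P y -> lspan Q y) -> lspan P x -> lspan Q x.
Proof.
move=> PQ; elim=> [|c u v Pu _ IH]; first exact: lspan0.
by apply: lspanD => //; apply/lspanZ/PQ.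
Qed.

(** With [eq g] for [P] or [Q], as below, it reduces multiplication by a fixed [g] to the spanning
    elements. *)
Lemma lspanM (K : comNzRingType) (A : algType K) (P Q S : A -> Prop) :
  (forall x y, P x -> Q y -> lspan S (x * y)) ->
  forall x y, lspan P x -> lspan Q y -> lspan S (x * y).
Proof.
move=> PQ x y Sx Sy; elim: Sx => [|c u v Pu _ IH]; first by rewrite mul0r;
  exact: lspan0.
rewrite mulrDl -scalerAl; apply: lspanD => //; apply: lspanZ.
elim: Sy => [|d w z Qw _ IH']; first by rewrite mulr0; exact: lspan0.
by rewrite mulrDr -scalerAr; apply: lspanD => //; apply/lspanZ/PQ.
Qed.

Lemma lspan_seqP (K : comNzRingType) (V : lmodType K) (s : seq V) x :
  lspan (fun y => y \in s) x ->
  exists c : nat -> K, x = \sum_(i < size s) c i *: s`_i.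
Proof.
elim=> [|c u v us _ [d ->]].
  by exists (fun=> 0); rewrite big1 // => i _; rewrite scale0r.
have iu : (index u s < size s)%N by rewrite index_mem.
(* The coefficient goes to the first occurrence of [u], since [s] may have repetitions. *)
exists (fun i => (if i == index u s then c else 0) + d i).
under [RHS]eq_bigr do rewrite scalerDl.
rewrite [RHS]big_split /=; congr (_ + _).
rewrite (bigD1 (Ordinal iu)) //= eqxx nth_index // big1 ?addr0 // => i.
by rewrite -val_eqE /= => /negPf ->; rewrite scale0r.
Qed.

Section Monomials.
Variable p : nat.

Definition seq_mul (A : nzRingType) (s t : seq A) : seq A :=
  [seq x * y | x <- s, y <- t].

Definition powers (A : nzRingType) (x : A) : seq A := [seq x ^+ i | i <- iota 0 p].

Definition level_monomials (A : nzRingType) (e f : A) : seq A :=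
  seq_mul (seq_mul (powers f) (powers (brk e f))) (powers e).

(** A sequence, so that its length is [p ^ (3 N)] in every ring, even where some monomials
    coincide. *)
Fixpoint monomials (A : nzRingType) (e f : nat -> A) (N : nat) : seq A :=
  if N is N'.+1 then seq_mul (monomials e f N') (level_monomials (e N') (f N'))
  else [:: 1].

Lemma size_monomials (A : nzRingType) (e f : nat -> A) N :
  size (monomials e f N) = (p ^ N * p ^ N * p ^ N)%N.
Proof.
elim: N => [|N IH] //=; rewrite !size_allpairs IH !size_map size_iota.
by rewrite expnS; lia.
Qed.

Section Map.
Variables (A B : nzRingType) (g : {rmorphism A -> B}).

Lemma map_seq_mul (s t : seq A) : map g (seq_mul s t) = seq_mul (map g s) (map g t).
Proof.
rewrite /seq_mul map_allpairs allpairs_mapl allpairs_mapr.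
by apply: eq_allpairs => x y; rewrite rmorphM.
Qed.

Lemma map_powers (x : A) : map g (powers x) = powers (g x).
Proof. by rewrite /powers -map_comp; apply: eq_map => i; rewrite /= rmorphXn. Qed.

Lemma map_monomials (e f : nat -> A) N :
  map g (monomials e f N) = monomials (g \o e) (g \o f) N.
Proof.
elim: N => [|N IH] /=; first by rewrite rmorph1.
by rewrite !map_seq_mul IH !map_powers rmorph_brk.
Qed.

End Map.

End Monomials.

Section SpanningMonomials.
Variables (p : nat) (p_pr : prime p) (K : comNzRingType) (A : algType K).
Variables e f : nat -> A.
Hypothesis rel : forall u v, dist_rel p e f u v -> u = v.
Local Notation X k := (brk (e k) (f k)).

Inductive word (N : nat) : A -> Prop :=
| word1 : word N 1
| word_e k x : (k < N)%N -> word N x -> word N (e k * x)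
| word_f k x : (k < N)%N -> word N x -> word N (f k * x).

(* The subalgebra A_N. *)
Definition sub_level (N : nat) : A -> Prop := lspan (word N).

Lemma sub_level1 N : sub_level N 1.
Proof. exact/lspan_mem/word1. Qed.

Lemma sub_level_e N k : (k < N)%N -> sub_level N (e k).
Proof. by move=> kN; rewrite -[e k]mulr1; apply/lspan_mem/word_e/word1. Qed.

Lemma sub_level_f N k : (k < N)%N -> sub_level N (f k).
Proof. by move=> kN; rewrite -[f k]mulr1; apply/lspan_mem/word_f/word1. Qed.

Lemma sub_levelM N x y : sub_level N x -> sub_level N y -> sub_level N (x * y).
Proof.
apply: lspanM => {}x {}y wx wy; apply: lspan_mem;
  elim: wx => [|k u kN _ IH|k u kN _ IH].
- by rewrite mul1r.
- by rewrite -mulrA; apply: word_e.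
- by rewrite -mulrA; apply: word_f.
Qed.

Lemma sub_levelX N x n : sub_level N x -> sub_level N (x ^+ n).
Proof.
move=> Sx; elim: n => [|n IH]; first exact: sub_level1.
by rewrite exprS; apply: sub_levelM.
Qed.

Lemma sub_level_prod N (I : Type) (r : seq I) (P : pred I) (F : I -> A) :
  (forall i, P i -> sub_level N (F i)) -> sub_level N (\prod_(i <- r | P i) F i).
Proof. by move=> SF; apply: big_ind => //; [exact: sub_level1 | exact: sub_levelM]. Qed.

Lemma sub_level_brk N x y : sub_level N x -> sub_level N y -> sub_level N (brk x y).
Proof. by move=> Sx Sy; apply: lspanB; apply: sub_levelM. Qed.

(** As [brk x] is a derivation, checking it on the generators is enough. *)
Lemma sub_level_derivation N x :
  (forall k, (k < N)%N -> sub_level N (brk x (e k)) /\ sub_level N (brk x (f k))) ->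
  forall y, sub_level N y -> sub_level N (brk x y).
Proof.
move=> Sx y; elim=> [|c u v wu _ IH].
  by rewrite /brk mulr0 mul0r subrr; exact: lspan0.
have -> : brk x (c *: u + v) = c *: brk x u + brk x v.
  by rewrite /brk mulrDr mulrDl -scalerAr -scalerAl scalerBr opprD addrACA.
apply: lspanD => //; apply: lspanZ; elim: wu => {IH u v} [|k u kN wu IH|k u kN wu IH].
- by rewrite /brk mulr1 mul1r subrr; exact: lspan0.
- rewrite brkMr; apply: lspanD; apply: sub_levelM => //.
  + by have [] := Sx k kN.
  + exact: lspan_mem.
  + exact: sub_level_e.
- rewrite brkMr; apply: lspanD; apply: sub_levelM => //.
  + by have [] := Sx k kN.
  + exact: lspan_mem.
  + exact: sub_level_f.
Qed.

(** For [k < N], the relations write the brackets with [e k] and [f k] in terms of generators of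
    levels [k] to [N - 1]. *)
Lemma sub_level_brk_f N y : sub_level N y -> sub_level N (brk (f N) y).
Proof.
apply: sub_level_derivation => k kN; rewrite ![brk (f N) _]brkC.
have n0 : (0 < N - k)%N by rewrite subn_gt0.
have Nk : (k + (N - k))%N = N by rewrite subnKC // ltnW.
have := rel (rel_ff p e f k n0); have := rel (rel_ef p e f k n0);
  rewrite Nk /= => -> ->.
split; last by rewrite oppr0; exact: lspan0.
apply/lspanN/sub_levelM; last first.
  by apply: lspanD (sub_level1 N); apply: sub_level_brk;
    [exact: sub_level_e|exact: sub_level_f].
rewrite -signr_odd mulr_sign;
  suff S : sub_level N (\prod_(i < N - k) f (k + i) ^+ (p - 1)).
  by case: ifP => _ //; exact: lspanN.
apply: sub_level_prod => i _; apply/sub_levelX/sub_level_f.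
by have := ltn_ord i; lia.
Qed.

Lemma sub_level_brk_e N y : sub_level N y -> sub_level N (brk (e N) y).
Proof.
apply: sub_level_derivation => k kN; rewrite [brk (e N) (e _)]brkC.
have n0 : (0 < N - k)%N by rewrite subn_gt0.
have Nk : (k + (N - k))%N = N by rewrite subnKC // ltnW.
have := rel (rel_ee p e f k n0); have := rel (rel_fe p e f k n0);
  rewrite Nk /= => -> ->.
split; first by rewrite oppr0; exact: lspan0.
rewrite -mulrA -signr_odd mulr_sign; set y' := _ * _; suff S : sub_level N y'.
  by case: ifP => _ //; exact: lspanN.
apply: sub_levelM.
  by apply: lspanD (sub_level1 N); apply: sub_level_brk;
    [exact: sub_level_e|exact: sub_level_f].
apply: sub_level_prod => i _; apply/sub_levelX/sub_level_e.
by have := ltn_ord i; lia.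
Qed.

Section Level.
Variable N : nat.

(** The exponents are unbounded here; [mono_level] brings them below [p]. *)
Let mono (x : A) := exists i j l, x = f N ^+ i * X N ^+ j * e N ^+ l.

Let mono_f x : lspan mono x -> lspan mono (f N * x).
Proof.
move=> Mx; apply: (lspanM (P := eq (f N))) Mx; last exact: lspan_mem.
move=> _ _ <- [i [j [l ->]]]; apply: lspan_mem; exists i.+1, j, l.
by rewrite exprS !mulrA.
Qed.

(** Induction on the power of [f], with [X f = f X - 2 f]. *)
Let mono_X x : lspan mono x -> lspan mono (X N * x).
Proof.
move=> Mx; apply: (lspanM (P := eq (X N))) Mx; last exact: lspan_mem.
move=> _ _ <- [i [j [l ->]]]; elim: i => [|i IH].
  by apply: lspan_mem; exists 0%N, j.+1, l; rewrite !mul1r exprS !mulrA.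
have -> : X N * (f N ^+ i.+1 * X N ^+ j * e N ^+ l) =
  f N * (X N * (f N ^+ i * X N ^+ j * e N ^+ l)) - f N * (f N ^+ i * X N ^+ j * e N ^+
    l) *+ 2.
  have /eqP := rel (rel_Xf p e f N); rewrite subr_eq => /eqP /= Xf.
  by rewrite exprS !mulrA Xf !mulrDl addrC !mulNr -!mulrnAl.
apply: lspanB; first exact: mono_f.
by apply/lspanMn/mono_f/lspan_mem; exists i, j, l.
Qed.

(** In the case [i = 0], [e] is moved past the powers of [X]; then past those of [f], where
    [e f = f e + X] calls on [mono_X]. *)
Let mono_e x : lspan mono x -> lspan mono (e N * x).
Proof.
move=> Mx; apply: (lspanM (P := eq (e N))) Mx; last exact: lspan_mem.
move=> _ _ <- [i [j [l ->]]]; elim: i => [|i IH].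
  rewrite mul1r; elim: j => [|j IH].
    by apply: lspan_mem; exists 0%N, 0%N, l.+1; rewrite !mul1r exprS.
  have -> : e N * (X N ^+ j.+1 * e N ^+ l) =
    X N * (e N * (X N ^+ j * e N ^+ l)) - e N * (X N ^+ j * e N ^+ l) *+ 2.
    have eX : e N * X N = X N * e N - e N *+ 2.
      by rewrite -(rel (rel_Xe p e f N)) /= {2}/brk opprB addrC subrK.
    by rewrite exprS !mulrA eX !mulrBl -!mulrnAl.
  by apply: lspanB; [exact: mono_X | exact: lspanMn].
have -> : e N * (f N ^+ i.+1 * X N ^+ j * e N ^+ l) =
  f N * (e N * (f N ^+ i * X N ^+ j * e N ^+ l)) +
    X N * (f N ^+ i * X N ^+ j * e N ^+ l).
  by rewrite exprS !mulrA -!mulrDl addrC subrK.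
apply: lspanD; first exact: mono_f.
by apply/mono_X/lspan_mem; exists i, j, l.
Qed.

Let mixed (x : A) := exists a m, [/\ sub_level N a, lspan mono m & x = a * m].

(** Both terms of [g a m = [g, a] m + a (g m)] are again mixed. *)
Let mixed_mul (g x : A) : (forall m, lspan mono m -> lspan mono (g * m)) ->
  (forall a, sub_level N a -> sub_level N (brk g a)) ->
  lspan mixed x -> lspan mixed (g * x).
Proof.
move=> gM gS Sx; apply: (lspanM (P := eq g)) Sx; last exact: lspan_mem.
move=> _ _ <- [a [m [Sa Mm ->]]]; rewrite mulrA -[g * a](subrK (a * g)) mulrDl -mulrA.
by apply: lspanD; apply: lspan_mem; [exists (brk g a), m | exists a, (g * m)]; split;
  auto.
Qed.

Let mixed_sub g x : sub_level N g -> lspan mixed x -> lspan mixed (g * x).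
Proof.
move=> Sg Sx; apply: (lspanM (P := eq g)) Sx; last exact: lspan_mem.
move=> _ _ <- [a [m [Sa Mm ->]]]; apply: lspan_mem; exists (g * a), m.
by split=> //; [exact: sub_levelM | rewrite mulrA].
Qed.

Let sub_levelS_mixed x : sub_level N.+1 x -> lspan mixed x.
Proof.
apply: lspan_trans => {}x; elim=> [|k u kN _ IH|k u kN _ IH].
- apply: lspan_mem; exists 1, 1; rewrite mulr1; split=> //; first exact: sub_level1.
  by apply: lspan_mem; exists 0%N, 0%N, 0%N; rewrite !mul1r.
- move: kN; rewrite ltnS leq_eqVlt => /predU1P[->|kN].
    by apply: mixed_mul => //; exact: sub_level_brk_e.
  by apply: mixed_sub => //; exact: sub_level_e.
- move: kN; rewrite ltnS leq_eqVlt => /predU1P[->|kN].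
    by apply: mixed_mul => //; exact: sub_level_brk_f.
  by apply: mixed_sub => //; exact: sub_level_f.
Qed.

(** Nilpotence of [e N] and [f N] bounds their exponents, and [X^p = X] lowers an exponent [j >= p]
    of [X] by [p - 1]. *)
Let mono_level x : mono x -> lspan (fun y => y \in level_monomials p (e N) (f N)) x.
Proof.
have p0 := prime_gt0 p_pr.
have nil (y : A) n : y ^+ p = 0 -> (p <= n)%N -> y ^+ n = 0.
  by move=> yp pn; rewrite -(subnK pn) exprD yp mulr0.
case=> i [j [l ->]].
have [ip|ip] := leqP p i.
  by rewrite (nil (f N) i (rel (rel_fp p e f N))) // !mul0r; exact: lspan0.
have [lp|lp] := leqP p l.
  by rewrite (nil (e N) l (rel (rel_ep p e f N))) // !mulr0; exact: lspan0.
have [j' [jp ->]] : exists j', (j' < p)%N /\ X N ^+ j = X N ^+ j'.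
  elim/ltn_ind: j => j IH; have [pj|jp] := leqP p j; last by exists j.
  have [|j' [jp E]] := IH (j - p).+1; first by have := prime_gt1 p_pr; lia.
  exists j'; split=> //; rewrite -E -[in LHS](subnK pj) exprD (rel (rel_Xp p e f N)).
  by rewrite -exprSr.
apply/lspan_mem/allpairsP; exists (f N ^+ i * X N ^+ j', e N ^+ l); split=> //=.
  by apply/allpairsP; exists (f N ^+ i, X N ^+ j'); split=> //; apply: map_f;
    rewrite mem_iota.
by apply: map_f; rewrite mem_iota.
Qed.

Lemma sub_levelS_span x : sub_level N.+1 x ->
  lspan (fun y => exists a m, [/\ sub_level N a, m \in level_monomials p (e N) (f N)
                                & y = a * m]) x.
Proof.
move=> /sub_levelS_mixed; apply: lspan_trans => _ [a [m [Sa Mm ->]]].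
apply: (lspanM (P := eq a)) (lspan_trans mono_level Mm); last exact: lspan_mem.
by move=> _ y <- ym; apply: lspan_mem; exists a, y.
Qed.

End Level.

Lemma sub_level_span N x : sub_level N x -> lspan (fun y => y \in monomials p e f N) x.
Proof.
elim: N x => [|N IH] x.
  apply: lspan_trans => {}x; elim=> [|k u //|k u //].
  by apply: lspan_mem; rewrite inE.
move=> /sub_levelS_span; apply: lspan_trans => _ [a [m [Sa Mm ->]]].
apply: (lspanM (Q := eq m)) (IH _ Sa) _; last exact: lspan_mem.
by move=> y _ ys <-; apply: lspan_mem; apply: allpairs_f.
Qed.

End SpanningMonomials.

(** * Free algebras and presentations *)

Section FreeEval.
Variables (K : comNzRingType) (G : choiceType) (A : algType K) (f : G -> A).
Local Notation F := (free_alg K G).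

Let word_eval (m : {fmonom G}) : A := \prod_(g <- (m : seq G)) f g.

Fact word_eval_mmorphism : mmorphism word_eval.
Proof.
split=> [m1 m2|]; first by rewrite /word_eval fmM big_cat.
by rewrite /word_eval fm1 big_nil.
Qed.
HB.instance Definition _ :=
  monalg.isMultiplicative.Build {fmonom G} A word_eval word_eval_mmorphism.

Let free_evalE : free_eval f =1 mmap (in_alg A) word_eval :> (F -> A).
Proof. by move=> w; apply: eq_bigr => m _; rewrite mulr_algl. Qed.

Fact free_eval_zmod_morphism : zmod_morphism (free_eval f : F -> A).
Proof. by move=> x y; rewrite !free_evalE; exact: mmapB. Qed.

Fact free_eval_monoid_morphism : monoid_morphism (free_eval f : F -> A).
Proof.
have c (g : F) (m m' : {fmonom G}) : GRing.comm (in_alg A g@_m) (word_eval m').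
  by rewrite /GRing.comm mulr_algl mulr_algr.
have [mM m1] := commr_mmap_is_multiplicative c.
by split=> [|x y]; rewrite !free_evalE; [exact: m1 | exact: mM].
Qed.

Fact free_eval_scalable : scalable (free_eval f : F -> A).
Proof. by move=> a x; rewrite !free_evalE [LHS]mmapZ mulr_algl. Qed.

HB.instance Definition _ :=
  GRing.isZmodMorphism.Build F A (free_eval f) free_eval_zmod_morphism.
HB.instance Definition _ :=
  GRing.isMonoidMorphism.Build F A (free_eval f) free_eval_monoid_morphism.
HB.instance Definition _ :=
  GRing.isScalable.Build K F A *:%R (free_eval f) free_eval_scalable.

Lemma free_eval_gen (g : G) : free_eval f (free_gen K g) = f g.
Proof.
by rewrite free_evalE [LHS]mmapU /= scale1r mul1r /word_eval fmU big_seq1.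
Qed.

End FreeEval.

Lemma malg_unitZ (K : comNzRingType) (M : monomType) (c : K) (m : M) :
  << c *g m >> = c *: << m >> :> {malg K[M]}.
Proof. by apply/malgP => k; rewrite mcoeffZ !mcoeffU mulrnAr mulr1. Qed.

Lemma free_algE (K : comNzRingType) (G : choiceType) (w : free_alg K G) :
  w = \sum_(m <- msupp w) w@_m *: \prod_(g <- (m : {fmonom G}) : seq G) free_gen K g.
Proof.
have consE g s : << FMonom (g :: s) >> = free_gen K g * << FMonom s >> :> free_alg K G.
  rewrite [RHS]fgmulUU mulr1 /mmul /= fmmulE fmuE //.
rewrite {1}[w]monalgE; apply: eq_bigr => m _.
transitivity (w@_m *: (<< m >> : {malg K[{fmonom G}]})).
  by exact: malg_unitZ.
congr (_ *: _); rewrite -[m in LHS]fmK.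
elim: (m : seq G) => [|g s IH]; first by rewrite big_nil -fmoneE.
by rewrite big_cons -IH consE.
Qed.

Section SubLevelMap.
Variables (K : comNzRingType) (A B : algType K) (g : {lrmorphism A -> B}).

Lemma sub_level_map (e f : nat -> A) (N : nat) (x : A) :
  sub_level e f N x -> sub_level (g \o e) (g \o f) N (g x).
Proof.
elim=> [|c u v wu _ IH]; first by rewrite raddf0; exact: lspan0.
rewrite linearP; apply: lspan_cons => //.
elim: wu => [|k w kN _ ww|k w kN _ ww]; first by rewrite rmorph1; exact: word1.
  by rewrite rmorphM; exact: word_e.
by rewrite rmorphM; exact: word_f.
Qed.

End SubLevelMap.

Section FreeSubLevel.
Variables (K : comNzRingType).
Local Notation F := (free_alg K (nat + nat)%type).

(** Only finitely many generators occur in [w]; the successor in [bd] makes [N] a strict bound on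
    their levels. *)
Lemma free_sub_level (w : F) :
  exists N, sub_level (fun k => free_gen K (inl k)) (fun k => free_gen K (inr k)) N w.
Proof.
pose ix (i : nat + nat) := match i with inl k => k | inr k => k end.
pose bd (m : {fmonom (nat + nat)%type}) := \max_(i <- (m : seq _)) (ix i).+1.
have : forall m, m \in msupp w -> (bd m <= \max_(m <- msupp w) bd m)%N.
  by move=> m mw; rewrite (big_rem m mw) leq_maxl.
move: (\max_(m <- _) _) => N wN; exists N.
rewrite [w in sub_level _ _ _ w]free_algE big_seq; apply: big_ind.
- exact: lspan0.
- by move=> x y; exact: lspanD.
move=> m /wN; rewrite /bd => mN; apply/lspanZ.
elim: (m : seq _) mN => [|i s IH]; first by rewrite !big_nil => _; exact: sub_level1.
rewrite !big_cons geq_max => /andP[iN /IH]; apply: sub_levelM.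
by case: i iN => k kN; [exact: sub_level_e | exact: sub_level_f].
Qed.

End FreeSubLevel.

Section PresentedAlgebra.
Variables (K : comNzRingType) (G : choiceType) (A : algType K) (gen : G -> A).
Variable rel : free_alg K G -> free_alg K G -> Prop.

Definition holds_in := forall u v, rel u v -> free_eval gen u = free_eval gen v.

(* [holds_in] is an argument because it makes the ideal proper. *)
Definition rel_ideal of holds_in : {pred free_alg K G} :=
  [pred w | `[< ideal_gen rel w >]].

Variable rel_holds : holds_in.

Lemma free_eval_ideal w : ideal_gen rel w -> free_eval gen w = 0.
Proof. exact: (ideal_gen_ker (f := free_eval gen)). Qed.

Fact rel_ideal_idealr_closed : idealr_closed (rel_ideal rel_holds).
Proof.
split.
- by apply/asboolP; exact: ideal_gen0.
- apply/negP => /asboolP/free_eval_ideal; rewrite rmorph1 => /eqP.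
  by rewrite oner_eq0.
- move=> a u v /asboolP Iu /asboolP Iv; apply/asboolP.
  by apply: ideal_gen_add => //; exact: ideal_gen_mull.
Qed.
HB.instance Definition _ :=
  isIdealr.Build _ (rel_ideal rel_holds) rel_ideal_idealr_closed.

Fact rel_ideal_right a :
  {in rel_ideal rel_holds, forall u, u * a \in rel_ideal rel_holds}.
Proof. by move=> u /asboolP Iu; apply/asboolP; exact: ideal_gen_mulr. Qed.
HB.instance Definition _ :=
  isRightStable.Build _ (rel_ideal rel_holds) rel_ideal_right.

(** The algebra defined by the relations alone, in which [sub_level_span] will be applied. *)
Definition presented_alg : Type := quot2 (rel_ideal rel_holds).
HB.instance Definition _ := GRing.Algebra.on presented_alg.

Definition presented_proj : {lrmorphism free_alg K G -> presented_alg} :=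
  to_quot2 (rel_ideal rel_holds).

Lemma presented_proj_eq u v :
  presented_proj u = presented_proj v <-> ideal_gen rel (u - v).
Proof. by rewrite to_quot2_eq; split => [/asboolP|H] //; apply/asboolP. Qed.

End PresentedAlgebra.

Section DistRelMorphism.
Variables (p : nat) (A B : nzRingType) (g : {rmorphism A -> B}) (e f : nat -> A).

Let g_sign n : g ((-1) ^+ n) = (-1) ^+ n.
Proof. by rewrite rmorphXn rmorphN1. Qed.

Let g_addr1 x : g (x + 1) = g x + 1.
Proof. by rewrite rmorphD /= rmorph1. Qed.

(** Serves to show that the images of the generators satisfy the relations in [presented_alg], whose
    ideal is generated by relations in the free algebra. *)
Lemma dist_rel_lift u v : dist_rel p (g \o e) (g \o f) u v ->
  exists u' v', [/\ dist_rel p e f u' v', u = g u' & v = g v'].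
Proof.
case=> {u v} [k|k|k n n0|k n n0|k n n0|k n n0|k n n0|k n n0|k|k|k] /=.
- by do 2!eexists; split; [exact: rel_Xe k | rewrite !rmorph_brk | rewrite rmorphMn].
- by do 2!eexists; split;
  [exact: rel_Xf k | rewrite !rmorph_brk | rewrite rmorphN rmorphMn].
- by do 2!eexists; split;
  [exact: (rel_Xe0 p e f k n0) | rewrite !rmorph_brk | rewrite rmorph0].
- by do 2!eexists; split;
  [exact: (rel_Xf0 p e f k n0) | rewrite !rmorph_brk | rewrite rmorph0].
- by do 2!eexists; split;
  [exact: (rel_ee p e f k n0) | rewrite !rmorph_brk | rewrite rmorph0].
- by do 2!eexists; split;
  [exact: (rel_ff p e f k n0) | rewrite !rmorph_brk | rewrite rmorph0].
- do 2!eexists; split; [exact: (rel_ef p e f k n0) | by rewrite !rmorph_brk |].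
  rewrite /= !rmorphM g_sign g_addr1 rmorph_brk rmorph_prod.
  by congr (_ * _ * _); apply: eq_bigr => i _; rewrite rmorphXn.
- do 2!eexists; split; [exact: (rel_fe p e f k n0) | by rewrite !rmorph_brk |].
  rewrite /= !rmorphM g_sign g_addr1 rmorph_brk rmorph_prod.
  by congr (_ * _ * _); apply: eq_bigr => i _; rewrite rmorphXn.
- by do 2!eexists; split;
  [exact: (rel_ep p e f k) | rewrite rmorphXn | rewrite rmorph0].
- by do 2!eexists; split;
  [exact: (rel_fp p e f k) | rewrite rmorphXn | rewrite rmorph0].
- by do 2!eexists; split;
  [exact: (rel_Xp p e f k) | rewrite rmorphXn rmorph_brk | rewrite rmorph_brk].
Qed.

Lemma dist_rel_map u v : dist_rel p e f u v -> dist_rel p (g \o e) (g \o f) (g u) (g v).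
Proof.
case=> {u v} [k|k|k n n0|k n n0|k n n0|k n n0|k n n0|k n n0|k|k|k] /=.
- by rewrite !rmorph_brk rmorphMn; exact: (rel_Xe p (g \o e) (g \o f)).
- by rewrite !rmorph_brk rmorphN rmorphMn; exact: (rel_Xf p (g \o e) (g \o f)).
- by rewrite !rmorph_brk rmorph0; exact: (rel_Xe0 p (g \o e) (g \o f)).
- by rewrite !rmorph_brk rmorph0; exact: (rel_Xf0 p (g \o e) (g \o f)).
- by rewrite !rmorph_brk rmorph0; exact: (rel_ee p (g \o e) (g \o f)).
- by rewrite !rmorph_brk rmorph0; exact: (rel_ff p (g \o e) (g \o f)).
- rewrite !rmorphM g_sign g_addr1 !rmorph_brk rmorph_prod.
  under eq_bigr do rewrite rmorphXn; exact: (rel_ef p (g \o e) (g \o f)).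
- rewrite !rmorphM g_sign g_addr1 !rmorph_brk rmorph_prod.
  under eq_bigr do rewrite rmorphXn; exact: (rel_fe p (g \o e) (g \o f)).
- by rewrite rmorphXn rmorph0; exact: (rel_ep p (g \o e) (g \o f)).
- by rewrite rmorphXn rmorph0; exact: (rel_fp p (g \o e) (g \o f)).
- by rewrite rmorphXn rmorph_brk; exact: (rel_Xp p (g \o e) (g \o f)).
Qed.

End DistRelMorphism.

(** * A criterion for the presentation *)

Section Criterion.
Variables (p : nat) (p_pr : prime p) (A : algType 'F_p) (gen : nat + nat -> A).
Local Notation F := (free_alg 'F_p (nat + nat)%type).
Let e k := gen (inl k).
Let f k := gen (inr k).
Hypothesis rel : forall u v, dist_rel p e f u v -> u = v.
Hypothesis free : forall N (c : nat -> 'F_p),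
  \sum_(i < size (monomials p e f N)) c i *: (monomials p e f N)`_i = 0 ->
  forall i, (i < size (monomials p e f N))%N -> c i = 0.
Hypothesis span : forall a, exists N, sub_level e f N a.

Let ev : {lrmorphism F -> A} := free_eval gen.

Let ev_e : ev \o free_e p = e.
Proof. by apply/funext => k; exact: free_eval_gen. Qed.

Let ev_f : ev \o free_f p = f.
Proof. by apply/funext => k; exact: free_eval_gen. Qed.

Let rel_holds : holds_in gen (dist_rel p (free_e p) (free_f p)).
Proof. by move=> u v /(dist_rel_map ev); rewrite ev_e ev_f; exact: rel. Qed.

(** A word [w] that vanishes in [A] is congruent modulo the relations to a combination [w'] of
    monomials. Then [w'] vanishes in [A] too, so independence makes its coefficients zero and [w]
    lies in the ideal. *)
Lemma presented_by_monomials : presented_by gen (dist_rel p (free_e p) (free_f p)).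
Proof.
split=> [a|w].
  have [N] := span a; elim=> [|c x y wx _ [v <-]]; first by exists 0; exact: raddf0.
  suff [u <-] : exists u, ev u = x by exists (c *: u + v); exact: linearP.
  elim: wx => {x} [|k x _ _ [u <-]|k x _ _ [u <-]].
  - by exists 1; exact: rmorph1.
  - by exists (free_e p k * u); rewrite rmorphM; congr (_ * _); exact: free_eval_gen.
  - by exists (free_f p k * u); rewrite rmorphM; congr (_ * _); exact: free_eval_gen.
split=> [w0|]; last exact: free_eval_ideal.
pose pi := presented_proj rel_holds.
have pi_rel u v : dist_rel p (pi \o free_e p) (pi \o free_f p) u v -> u = v.
  move=> /dist_rel_lift[u' [v' [uv -> ->]]]; apply/presented_proj_eq.
  by have := ideal_genD 1 1 uv (ideal_gen0 _); rewrite mul1r mulr1 addr0.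
have [N /(sub_level_map pi) Sw] := free_sub_level w.
have [c] := lspan_seqP (sub_level_span p_pr pi_rel Sw).
rewrite -map_monomials size_map; set M := monomials _ _ _ _ => wc.
pose w' := \sum_(i < size M) c i *: M`_i.
have piw' : pi w = pi w'.
  by rewrite wc linear_sum; apply: eq_bigr => i _; rewrite linearZ (nth_map 0).
have Iw : ideal_gen (dist_rel p (free_e p) (free_f p)) (w - w').
  by have /presented_proj_eq := piw'.
suff w'0 : w' = 0 by rewrite w'0 subr0 in Iw.
have MN : map ev M = monomials p e f N by rewrite map_monomials ev_e ev_f.
have c0 : forall i, (i < size (monomials p e f N))%N -> c i = 0.
  apply: free; rewrite -MN size_map.
  have : ev w' = 0.
    have := free_eval_ideal rel_holds Iw; rewrite rmorphB /= w0 sub0r => /eqP.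
    by rewrite oppr_eq0 => /eqP.
  apply: etrans; rewrite linear_sum; apply: eq_bigr => i _.
  by rewrite linearZ (nth_map 0).
apply: big1 => i _; rewrite c0 ?scale0r //.
by rewrite -MN size_map.
Qed.

End Criterion.

(** * The PBW theorem for sl_2 over the rationals *)

Lemma ffactr_natr (R : nzRingType) (m n : nat) : ffactr (m%:R : R) n = (m ^_ n)%:R.
Proof.
elim: n => [|n IH]; first by rewrite ffactr0.
rewrite ffactrS IH ffactnSr; have [nm|mn] := leqP n m; first by rewrite natrM natrB.
by rewrite ffact_small // mul0r mul0n.
Qed.

Section IrreducibleModule.
Variable n : nat.
Local Notation M := 'M[rat]_n.+1.

(* The irreducible module of highest weight n, in the basis f^j v / j!. *)
Definition irr_e : M := \matrix_(i, j) ((i.+1 == j :> nat)%:R * (n - i)%:R).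
Definition irr_f : M := \matrix_(i, j) ((i == j.+1 :> nat)%:R * i%:R).
Definition irr_h : M := \matrix_(i, j) ((i == j)%:R * (n%:R - 2%:R * i%:R)).

(** The index is any natural number, with value 0 beyond [n], so that the action of [irr_f] needs no
    separate case at the end of the basis. *)
Definition wvec (j : nat) : 'cV[rat]_n.+1 := \col_i (i == j :> nat)%:R.

Lemma wvec0 (j : nat) : (n < j)%N -> wvec j = 0.
Proof.
move=> nj; apply/colP => i; rewrite !mxE; case: eqP => // ij.
by have := ltn_ord i; rewrite ij ltnNge nj.
Qed.

Lemma mulmx_wvec (A : M) (j : 'I_n.+1) : A *m wvec j = col j A.
Proof.
apply/colP => i; rewrite !mxE (bigD1 j) //= big1 => [|k kj].
  by rewrite !mxE eqxx mulr1 addr0.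
by rewrite !mxE val_eqE (negPf kj) mulr0.
Qed.

Lemma wvec_ext (A B : M) : (forall j, (j <= n)%N -> A *m wvec j = B *m wvec j) -> A = B.
Proof.
move=> AB; apply/matrixP => i j.
by have /colP/(_ i) := AB j (ltn_ord j); rewrite !mulmx_wvec !mxE.
Qed.

Lemma irr_e_wvec (j : nat) : irr_e *m wvec j.+1 = (n - j)%:R *: wvec j.
Proof.
have [jn|nj] := ltnP j n; last first.
  by rewrite wvec0 // mulmx0 (eqP nj) scale0r.
rewrite (mulmx_wvec _ (Ordinal (jn : (j.+1 < n.+1)%N))); apply/colP => i;
  rewrite !mxE /=.
by rewrite eqSS; case: eqP => [->|_]; rewrite ?mul1r ?mulr1 ?mul0r ?mulr0.
Qed.

Lemma irr_e_wvec0 : irr_e *m wvec 0 = 0.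
Proof. by rewrite (mulmx_wvec _ ord0); apply/colP => i; rewrite !mxE mul0r. Qed.

Lemma irr_f_wvec (j : nat) : irr_f *m wvec j = j.+1%:R *: wvec j.+1.
Proof.
have [jn|nj] := leqP j n; last first.
  by rewrite !wvec0 ?mulmx0 ?scaler0 // ltnW.
rewrite (mulmx_wvec _ (Ordinal (jn : (j < n.+1)%N))); apply/colP => i; rewrite !mxE /=.
by case: eqP => [->|_]; rewrite ?mul1r ?mulr1 ?mul0r ?mulr0.
Qed.

Lemma irr_h_wvec (j : nat) : irr_h *m wvec j = (n%:R - 2%:R * j%:R) *: wvec j.
Proof.
have [jn|nj] := leqP j n; last by rewrite !wvec0 ?mulmx0 ?scaler0.
rewrite (mulmx_wvec _ (Ordinal (jn : (j < n.+1)%N))); apply/colP => i; rewrite !mxE /=.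
rewrite -val_eqE /=; by case: eqP => [->|_]; rewrite ?mul1r ?mulr1 ?mul0r ?mulr0.
Qed.

Let brk_wvec (A B : M) (v : 'cV_n.+1) : brk A B *m v = A *m (B *m v) - B *m (A *m v).
Proof. by rewrite mulmxBl !mulmxA. Qed.

Lemma irr_ef : brk irr_e irr_f = irr_h.
Proof.
apply: wvec_ext => j jn; rewrite brk_wvec irr_f_wvec irr_h_wvec -scalemxAr irr_e_wvec.
case: j jn => [|j] jn.
  by rewrite irr_e_wvec0 mulmx0 subr0 scalerA mul1r subn0 mulr0 subr0.
rewrite irr_e_wvec -scalemxAr irr_f_wvec !scalerA -scalerBl; congr (_ *: _).
by rewrite !natrB -?natr1; [ring | lia..].
Qed.

Lemma irr_he : brk irr_h irr_e = 2%:R *: irr_e.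
Proof.
apply: wvec_ext => j jn; rewrite brk_wvec irr_h_wvec -!scalemxAr -scalemxAl.
case: j jn => [|j] jn; first by rewrite irr_e_wvec0 !mulmx0 !scaler0 subrr.
rewrite irr_e_wvec -!scalemxAr irr_h_wvec !scalerA -scalerBl; congr (_ *: _).
by rewrite -natr1; ring.
Qed.

Lemma irr_hf : brk irr_h irr_f = - (2%:R *: irr_f).
Proof.
apply: wvec_ext => j jn; rewrite brk_wvec irr_h_wvec -!scalemxAr mulNmx -scalemxAl.
rewrite irr_f_wvec -!scalemxAr irr_h_wvec !scalerA -scalerBl -scaleNr; congr (_ *: _).
by rewrite -natr1; ring.
Qed.

Lemma irr_e_exp_wvec_lt (c j : nat) : (j < c)%N -> irr_e ^+ c *m wvec j = 0.
Proof.
elim: c j => // c IH j; rewrite exprSr -mulmxA.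
case: j => [|j] jc; first by rewrite irr_e_wvec0 mulmx0.
by rewrite irr_e_wvec -scalemxAr IH ?scaler0.
Qed.

Lemma irr_e_exp_wvec (c : nat) : irr_e ^+ c *m wvec c = (n ^_ c)%:R *: wvec 0.
Proof.
elim: c => [|c IH]; first by rewrite mul1mx scale1r.
by rewrite exprSr -mulmxA irr_e_wvec -scalemxAr IH scalerA mulrC -natrM -ffactnSr.
Qed.

Lemma irr_f_exp_wvec (a : nat) : irr_f ^+ a *m wvec 0 = a`!%:R *: wvec a.
Proof.
elim: a => [|a IH]; first by rewrite mul1mx scale1r.
by rewrite exprS -mulmxA IH -scalemxAr irr_f_wvec scalerA -natrM mulnC -factS.
Qed.

Lemma irr_h_ffactr_wvec (b : nat) : ffactr irr_h b *m wvec 0 = (n ^_ b)%:R *: wvec 0.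
Proof.
elim: b => [|b IH]; first by rewrite ffactr0 mul1mx scale1r.
rewrite ffactrS -mulmxA mulmxBl irr_h_wvec mulr0 subr0.
have -> : (b%:R : M) *m wvec 0 =
  b%:R *: wvec 0 by rewrite -[b%:R]scaler_nat -scalemxAl mul1mx.
rewrite -scalerBl -scalemxAr IH scalerA; congr (_ *: _).
by rewrite -!ffactr_natr ffactrS mulrC.
Qed.

(** The power of [e] carries the vector to the highest weight line, where [h] acts by [n], and the
    power of [f] then moves it to index [a]. *)
Lemma irr_kostant_wvec (a b c : nat) :
  kostant_mon irr_e irr_f irr_h (a, b, c) *m wvec c =
  ('C(n, c)%:R * ((b`!%:R)^-1 * ffactr n%:R b)) *: wvec a.
Proof.
rewrite /kostant_mon /= /divpow /binomA -[\prod_(i < b) _]/(ffactr irr_h b).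
rewrite -!scalerAr -!scalerAl -!scalemxAl -!mulmxA irr_e_exp_wvec -!scalemxAr.
rewrite irr_h_ffactr_wvec -!scalemxAr irr_f_exp_wvec !scalerA; congr (_ *: _).
have nz m : (m`!%:R : rat) != 0 by rewrite Num.Theory.pnatr_eq0 -lt0n fact_gt0.
rewrite ffactr_natr -(bin_ffact n c) natrM; field.
by rewrite !nz.
Qed.

Lemma irr_kostant_wvec_lt (t : nat * nat * nat) (c : nat) : (c < t.2)%N ->
  kostant_mon irr_e irr_f irr_h t *m wvec c = 0.
Proof.
move=> ct; rewrite /kostant_mon -mulmxA /divpow -[X in _ *m X]scalemxAl.
by rewrite irr_e_exp_wvec_lt // scaler0 mulmx0.
Qed.

End IrreducibleModule.

Lemma poly_natr_eq0 (P : {poly rat}) (m : nat) :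
  (forall n, (m <= n)%N -> P.[n%:R] = 0) -> P = 0.
Proof.
move=> P0; apply: (@roots_geq_poly_eq0 _ _ [seq j%:R | j <- iota m (size P)]).
- by apply/allP => x /mapP[j]; rewrite mem_iota => /andP[mj _] ->; apply/eqP/P0.
- by rewrite map_inj_uniq ?iota_uniq // => i j /eqP; rewrite Num.Theory.eqr_nat => /eqP.
- by rewrite size_map size_iota.
Qed.

(* Applied to the vector of index c, the terms with a larger power of e vanish and
   those with a smaller one are removed by induction. What remains is, up to a
   nonzero factor, a polynomial in the highest weight n with infinitely many roots. *)
Lemma irr_kostant_free (R : seq (nat * nat * nat)) (C : nat * nat * nat -> rat) :
  uniq R ->
  (forall n, \sum_(t <- R) C t *: kostant_mon (irr_e n) (irr_f n) (irr_h n) t = 0) ->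
  forall t, t \in R -> C t = 0.
Proof.
move=> uR H [[a b] c]; elim/ltn_ind: c a b => c IHc a.
have Cc t : t \in R -> (t.2 < c)%N -> C t = 0.
  by case: t => -[a' b'] c' tR /= c'c; exact: IHc tR.
pose G (t : nat * nat * nat) := (t.1.1 == a) && (t.2 == c).
(* For large [n], the value of [P] at [n] is the entry of index [a] of the image of [wvec n c],
   divided by ['C(n, c)]. *)
pose P : {poly rat} :=
  \sum_(t <- R | G t) (C t / (t.1.2)`!%:R) *: ffactr 'X t.1.2.
have ffX b x : (ffactr ('X : {poly rat}) b).[x] = ffactr x b.
  by have := rmorph_ffactr (horner_eval x) 'X b; rewrite /= /horner_eval hornerX.
have P0 : P = 0.
  (* These bounds on [n] put the index [a] in range and make ['C(n, c)] nonzero. *)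
  apply: (@poly_natr_eq0 _ (maxn a c)) => n; rewrite geq_max => /andP[an cn].
  have nz : 'C(n, c)%:R != 0 :> rat by rewrite Num.Theory.pnatr_eq0 -lt0n bin_gt0.
  apply: (mulfI nz); rewrite mulr0.
  have := congr1 (fun M => (M *m wvec n c) (inord a) 0) (H n).
  rewrite mul0mx mulmx_suml summxE [RHS]mxE => <-.
  rewrite horner_sum mulr_sumr [LHS]big_mkcond big_seq [RHS]big_seq.
  apply: eq_bigr => -[[a' b'] c'] tR; rewrite -scalemxAl mxE /G /=.
  have [c'c|cc'|->] := ltngtP c' c.
  - by rewrite andbF Cc // mul0r.
  - by rewrite andbF irr_kostant_wvec_lt // mxE mulr0.
  rewrite irr_kostant_wvec !mxE inordK // andbT eq_sym; case: eqP => _.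
    by rewrite mulr1 hornerZ ffX !mulrA; congr (_ * _); rewrite -!mulrA mulrCA.
  by rewrite !mulr0.
move=> b; elim/ltn_ind: b => b IHb tR.
(* At [b], the falling factorials of length above [b] vanish, and the shorter ones have zero
   coefficient by induction. *)
have := congr1 (fun Q : {poly rat} => Q.[b%:R]) P0.
rewrite horner0 /P horner_sum big_mkcond (bigD1_seq (a, b, c)) //= /G !eqxx /=.
rewrite big_seq_cond big1 => [|[[a' b'] c'] /andP[tR' nt]].
  rewrite addr0 hornerZ ffX ffactr_natr ffactnn => /eqP.
  rewrite divfK; first by move/eqP.
  by rewrite Num.Theory.pnatr_eq0 -lt0n fact_gt0.
rewrite /=; case: ifP => // /andP[/eqP aa /eqP cc]; rewrite hornerZ ffX ffactr_natr.
move: nt tR'; rewrite aa cc => nt tR'; have [bb|bb|bb] := ltngtP b' b.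
- by rewrite IHb // !mul0r.
- by rewrite ffact_small // mulr0.
- by rewrite bb eqxx in nt.
Qed.

Section Triples.
Variables (K : comNzRingType) (A : algType K) (e f h : A).
Hypotheses (he : brk h e = 2%:R *: e) (hf : brk h f = - (2%:R *: f))
  (ef : brk e f = h).

Let brkDl (x y z : A) : brk (x + y) z = brk x z + brk y z.
Proof. by rewrite /brk mulrDl mulrDr opprD addrACA. Qed.

Let brkDr (x y z : A) : brk x (y + z) = brk x y + brk x z.
Proof. by rewrite ![brk x _]brkC brkDl opprD. Qed.

Let brkZl (c : K) (x y : A) : brk (c *: x) y = c *: brk x y.
Proof. by rewrite /brk -scalerAl -scalerAr scalerBr. Qed.

Let brkZr (c : K) (x y : A) : brk x (c *: y) = c *: brk x y.
Proof. by rewrite ![brk x _]brkC brkZl scalerN. Qed.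

(** Used both for 2 by 2 matrices and for the target of a representation: equal structure constants
    make [rho] below compatible with brackets. *)
Lemma brk_triple (c d : K * K * K) :
  brk (c.1.1 *: e + c.1.2 *: f + c.2 *: h) (d.1.1 *: e + d.1.2 *: f + d.2 *: h) =
  (2%:R * (c.2 * d.1.1 - c.1.1 * d.2)) *: e +
  (2%:R * (c.1.2 * d.2 - c.2 * d.1.2)) *: f +
  (c.1.1 * d.1.2 - c.1.2 * d.1.1) *: h.
Proof.
case: c d => -[c1 c2] c3 [[d1 d2] d3] /=.
have xx x : brk x x = 0 :> A by rewrite /brk subrr.
have fe : brk f e = - h by rewrite brkC ef.
have eh : brk e h = - (2%:R *: e) by rewrite brkC he.
have fh : brk f h = 2%:R *: f by rewrite brkC hf opprK.
rewrite !(brkDl, brkDr, brkZl, brkZr) !xx ef fe he eh hf fh.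
rewrite !scaler0 !scalerN !scalerA !addr0 !add0r -!scaleNr.
rewrite [LHS](AC (2*2*2) ((2*5)*(4*6)*(1*3)))%AC /= -!scalerDl.
by congr (_ *: _ + _ *: _ + _ *: _); ring.
Qed.

End Triples.

Lemma rmorph_kostant_mon (A B : algType rat) (g : {lrmorphism A -> B}) (e f h : A) t :
  g (kostant_mon e f h t) = kostant_mon (g e) (g f) (g h) t.
Proof.
have gX x m : g (divpow x m) = divpow (g x) m by rewrite /divpow linearZ rmorphXn.
rewrite /kostant_mon !rmorphM /= !gX; congr (_ * _ * _).
by rewrite /binomA linearZ; congr (_ *: _); exact: rmorph_ffactr.
Qed.

Lemma lrmorph_kostant_sum (A B : algType rat) (g : {lrmorphism A -> B}) (e f h : A)
    (R : seq (nat * nat * nat)) (C : nat * nat * nat -> rat) :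
  g (\sum_(t <- R) C t *: kostant_mon e f h t) =
  \sum_(t <- R) C t *: kostant_mon (g e) (g f) (g h) t.
Proof.
by rewrite linear_sum; apply: eq_bigr => t _; rewrite linearZ /= rmorph_kostant_mon.
Qed.

Section PBW.
Variables (e f h : sl2 rat) (std : sl2_std_basis e f h).

Let comb (A : lmodType rat) (x y z : A) (c : rat * rat * rat) : A :=
  c.1.1 *: x + c.1.2 *: y + c.2 *: z.

Let comb_lin (A : lmodType rat) (x y z : A) (a : rat) (c d : rat * rat * rat) :
  comb x y z (a * c.1.1 + d.1.1, a * c.1.2 + d.1.2, a * c.2 + d.2) =
  a *: comb x y z c + comb x y z d.
Proof.
rewrite /comb /= !scalerDl !scalerDr !scalerA.
by rewrite [LHS](AC (2*2*2) ((1*3*5)*(2*4*6)))%AC.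
Qed.

Let coord_ex x : exists c, x = comb e f h c /\ forall d, x = comb e f h d -> c = d.
Proof. by case: std => _ _ _ /(_ x) [c [xc cU]]; exists c. Qed.

Let coord x := projT1 (cid (coord_ex x)).

Let coordE x : x = comb e f h (coord x).
Proof. by rewrite /coord; case: cid => c []. Qed.

Let coord_eq x d : x = comb e f h d -> coord x = d.
Proof. by rewrite /coord; case: cid => c [_] /= cU /cU. Qed.

Let coord_brk x y : coord (sl2_brk x y) =
  (2%:R * ((coord x).2 * (coord y).1.1 - (coord x).1.1 * (coord y).2),
   2%:R * ((coord x).1.2 * (coord y).2 - (coord x).2 * (coord y).1.2),
   (coord x).1.1 * (coord y).1.2 - (coord x).1.2 * (coord y).1.1).
Proof.
have brkE u v : sl2_mx (sl2_brk u v) = brk (sl2_mx u) (sl2_mx v) by [].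
have mxD u v : sl2_mx (u + v) = sl2_mx u + sl2_mx v by exact: (raddfD \val).
have mxZ a u : sl2_mx (a *: u) = a *: sl2_mx u by exact: (linearZZ \val a u).
have mxN u : sl2_mx (- u) = - sl2_mx u by exact: (raddfN \val).
have mxc c : sl2_mx (comb e f h c) = comb (sl2_mx e) (sl2_mx f) (sl2_mx h) c.
  by rewrite /comb !mxD !mxZ.
case: std => he hf ef _.
apply/coord_eq/val_inj; rewrite -[val _]/(sl2_mx _) brkE {1}(coordE x) {1}(coordE y).
rewrite -[RHS]/(sl2_mx _) !mxc; apply: brk_triple.
- by rewrite -brkE he mxZ.
- by rewrite -brkE hf mxN mxZ.
- by rewrite -brkE ef.
Qed.

Section Representation.
Variables (A : algType rat) (ae af ah : A).
Hypotheses (he : brk ah ae = 2%:R *: ae) (hf : brk ah af = - (2%:R *: af))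
  (ef : brk ae af = ah).

Let rho x := comb ae af ah (coord x).

Let rho_env w : ideal_gen (env_rel (@sl2_brk rat)) w -> free_eval rho w = 0.
Proof.
apply: (ideal_gen_ker (f := free_eval rho)) => _ _ [c x y|x y].
  rewrite [RHS]linearP /= !free_eval_gen /rho -comb_lin; congr comb.
  by apply: coord_eq; rewrite comb_lin -!coordE.
transitivity (brk (rho x) (rho y)); last first.
  apply: etrans (esym (free_eval_gen rho _)).
  by rewrite /rho coord_brk; exact: brk_triple.
apply: etrans; first exact: (rmorph_brk (free_eval rho)).
by congr brk; exact: free_eval_gen.
Qed.

Let rho_basis : [/\ rho e = ae, rho f = af & rho h = ah].
Proof.
split; rewrite /rho.
- rewrite (@coord_eq _ (1, 0, 0)); last by rewrite /comb /= scale1r !scale0r !addr0.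
  by rewrite /comb /= scale1r !scale0r !addr0.
- rewrite (@coord_eq _ (0, 1, 0));
  last by rewrite /comb /= scale1r !scale0r addr0 add0r.
  by rewrite /comb /= scale1r !scale0r addr0 add0r.
- rewrite (@coord_eq _ (0, 0, 1)); last by rewrite /comb /= scale1r !scale0r !add0r.
  by rewrite /comb /= scale1r !scale0r !add0r.
Qed.

(** The linear map [rho] preserves brackets, so evaluation of the free algebra along it kills the
    ideal defining the enveloping algebra. *)
Lemma env_kostant_rep (R : seq (nat * nat * nat)) (C : nat * nat * nat -> rat) :
  let u := env_in (@sl2_brk rat) in
  \sum_(t <- R) C t *: kostant_mon (u e) (u f) (u h) t = 0 ->
  \sum_(t <- R) C t *: kostant_mon ae af ah t = 0.
Proof.
move=> u; pose x (v : sl2 rat) : free_alg rat (sl2 rat) := free_gen rat v.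
pose w := \sum_(t <- R) C t *: kostant_mon (x e) (x f) (x h) t.
have w0 := lrmorph_kostant_sum (to_quot2 (env_ideal (@sl2_brk rat))) (x e) (x f) (x h)
  R C.
move=> S0; have : to_quot2 (env_ideal (@sl2_brk rat)) w = to_quot2 _ 0.
  by rewrite raddf0; exact: etrans w0 S0.
move=> /to_quot2_eq; rewrite subr0 => /asboolP Iw.
have [re rf rh] := rho_basis; have := rho_env Iw.
rewrite (lrmorph_kostant_sum (free_eval rho)) => S'0; apply: etrans S'0.
by apply: eq_bigr => t _; rewrite /x /= !free_eval_gen re rf rh.
Qed.

End Representation.

Lemma env_kostant_free (R : seq (nat * nat * nat)) (C : nat * nat * nat -> rat) :
  let u := env_in (@sl2_brk rat) in uniq R ->
  \sum_(t <- R) C t *: kostant_mon (u e) (u f) (u h) t = 0 ->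
  forall t, t \in R -> C t = 0.
Proof.
move=> u uR S0; apply: irr_kostant_free => // n.
by apply: env_kostant_rep S0; [exact: irr_he | exact: irr_hf | exact: irr_ef].
Qed.

End PBW.

(** * Dist(SL_2) *)

(* The square matrix expressing u in terms of s has trivial kernel, so it is
   invertible. *)
Lemma spanning_free (K : fieldType) (V : lmodType K) (s u : seq V) :
  size s = size u ->
  (forall x, x \in u -> lspan (fun y => y \in s) x) ->
  (forall c : nat -> K, \sum_(i < size u) c i *: u`_i = 0 ->
     forall i, (i < size u)%N -> c i = 0) ->
  forall c : nat -> K, \sum_(i < size s) c i *: s`_i = 0 ->
    forall i, (i < size s)%N -> c i = 0.
Proof.
move=> ssu su; rewrite ssu; set n := size u => u_free.
have [A uE] : exists A : 'M[K]_n, forall i : 'I_n, u`_i = \sum_j A i j *: s`_j.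
  have /(_ _)/cid-/all_sig[c cE] (i : 'I_n) : exists c : nat -> K, u`_i =
    \sum_(j < n) c j *: s`_j.
    by have := lspan_seqP (su _ (mem_nth 0 (ltn_ord i))); rewrite ssu.
  by exists (\matrix_(i, j) c i j) => i; rewrite cE; apply: eq_bigr => j _; rewrite mxE.
have sumE (x : 'rV[K]_n) : \sum_i x 0 i *: u`_i = \sum_j (x *m A) 0 j *: s`_j.
  under eq_bigr do rewrite uE scaler_sumr.
  rewrite exchange_big; apply: eq_bigr => j _; rewrite mxE scaler_suml.
  by apply: eq_bigr => i _; rewrite scalerA.
have u_inj (x : 'rV[K]_n) : \sum_i x 0 i *: u`_i = 0 -> x = 0.
  move=> x0; apply/rowP => i; rewrite mxE.
  have H := u_free (fun k => if insub k is Some j then x 0 j else 0).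
  have := H _ i (ltn_ord i); rewrite valK; apply; rewrite -[RHS]x0.
  by apply: eq_bigr => j _; rewrite valK.
have A_unit : A \in unitmx.
  rewrite -row_free_unit; apply/row_freeP; apply/row_freeP/inj_row_free => x xA.
  by apply: u_inj; rewrite sumE xA big1 // => j _; rewrite mxE scale0r.
move=> c c0 i ni; pose d : 'rV[K]_n := \row_j c j.
have : d *m invmx A = 0.
  apply: u_inj; rewrite sumE mulmxKV // -[RHS]c0.
  by apply: eq_bigr => j _; rewrite mxE.
move=> /(congr1 (mulmx^~ A)); rewrite mulmxKV // mul0mx => /rowP/(_ (Ordinal ni)).
by rewrite !mxE.
Qed.

Section KostantInSubLevel.
Variables (p : nat) (p_pr : prime p) (A : algType 'F_p).

Let Ap : p \in [pchar A]. Proof. by rewrite pchar_lalg pchar_Fp. Qed.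

Section Sequence.
Variables (x : nat -> A) (S : A -> Prop) (N : nat).
Hypothesis x0 : x 0 = 1.
Hypothesis xM : forall m n, x m * x n = x (m + n)%N *+ 'C(m + n, m).
Hypotheses (S1 : S 1) (SM : forall y z, S y -> S z -> S (y * z))
  (SZ : forall c y, S y -> S (c *: y)).
Hypothesis Sx : forall k, (k < N)%N -> S (x (p ^ k)).

(** Induction on [N], splitting off the top digit [i] of [m] in base [p]: as [i < p], the factorial
    of [i] is invertible in ['F_p], and [x (p ^ n * i)] is a multiple of a power of [x (p ^ n)]. *)
Lemma divpow_generated m : (m < p ^ N)%N -> S (x m).
Proof.
elim: N Sx m => [|n IH] Sx' m; first by rewrite ltnS leqn0 => /eqP->; rewrite x0.
have q0 : (0 < p ^ n)%N by rewrite expn_gt0 prime_gt0.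
have rq := ltn_pmod m q0; rewrite expnS mulnC => mp.
rewrite (divn_eq m (p ^ n)) mulnC -(divpow_mul_lt p_pr Ap xM _ rq).
apply: SM; last by apply: IH => // k kn; apply: Sx'; exact: ltnW.
have ip : (m %/ p ^ n < p)%N by rewrite ltn_divLR // mulnC.
move: (m %/ _)%N ip => i ip.
have nz : i`!%:R != 0 :> 'F_p.
  elim: i ip => [|i IHi] ip; first by rewrite oner_neq0.
  rewrite factS natrM mulf_neq0 ?IHi ?(ltnW ip) //.
  by rewrite -(dvdn_pcharf (pchar_Fp p_pr)) gtnNdvd.
have -> : x (p ^ n * i) = (i`!%:R : 'F_p)^-1 *: x (p ^ n) ^+ i.
  by rewrite (divpow_exp p_pr Ap x0 xM) -scaler_nat scalerA mulVf // scale1r.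
by apply: SZ; elim: i {ip nz} => // i IHi; rewrite exprS; apply: SM => //; exact: Sx'.
Qed.

End Sequence.

Variables (ed fd : nat -> A) (B : int -> nat -> A).
Hypothesis dp : divided_powers ed fd B.
Let e k := ed (p ^ k).
Let f k := fd (p ^ k).

Lemma sub_level_ed N m : (m < p ^ N)%N -> sub_level e f N (ed m).
Proof.
apply: (divpow_generated (S := sub_level e f N) (dp_e0 dp) (dp_ee dp)).
- exact: sub_level1.
- exact: sub_levelM.
- by move=> c y; exact: lspanZ.
- exact: sub_level_e.
Qed.

Lemma sub_level_fd N m : (m < p ^ N)%N -> sub_level e f N (fd m).
Proof.
apply: (divpow_generated (S := sub_level e f N) (dp_f0 dp) (dp_ff dp)).
- exact: sub_level1.
- exact: sub_levelM.
- by move=> c y; exact: lspanZ.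
- exact: sub_level_f.
Qed.

(** Pascal's rule, used upwards and downwards in [m], reduces every shift to [m = 0] and lower
    [j]. *)
Lemma sub_level_B_shift N j : (forall i, (i <= j)%N -> sub_level e f N (B 0 i)) ->
  forall m, sub_level e f N (B m j).
Proof.
elim: j => [|j IH] B0; first by move=> m; rewrite (dp_B0 dp); exact: sub_level1.
have Bj m : sub_level e f N (B m j) by apply: IH => i ij; apply: B0; exact: leqW.
elim/int_ind => [|n IHn|n IHn]; first exact: B0.
  by rewrite intS addrC (dp_BS dp); apply: lspanD; [exact: IHn | exact: Bj].
have := dp_BS dp (- n.+1%:Z) j; rewrite intS opprD addrAC addNr add0r -opprD => E.
by rewrite -[B _ _](addrK (B (- (1 + n%:Z)) j)) -E; apply: lspanB;
  [exact: IHn | exact: Bj].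
Qed.

(** [B 0 b] is the term [j = b] of Kostant's formula for [ed b * fd b]; the other terms only involve
    [B] of lower index, covered by induction. *)
Lemma sub_level_B N b : (b < p ^ N)%N -> sub_level e f N (B 0 b).
Proof.
elim/ltn_ind: b => b IH bN.
have := dp_ef dp b b; rewrite minnn big_ord_recr /= subnn (dp_f0 dp) (dp_e0 dp).
have -> : 2 * b%:Z - b%:Z - b%:Z = 0 by ring.
rewrite mul1r mulr1 => /(canLR (addKr _)) <-.
apply: lspanD; last first.
  by apply: sub_levelM; [exact: sub_level_ed | exact: sub_level_fd].
apply/lspanN/lspan_sum => -[j jb]; apply: sub_levelM; last first.
  by apply: sub_level_ed; rewrite /=; lia.
apply: sub_levelM; first by apply: sub_level_fd; rewrite /=; lia.
by apply: sub_level_B_shift => i ij; apply: IH; rewrite /= in ij *; lia.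
Qed.

End KostantInSubLevel.

Lemma divided_powers_map (A B : nzRingType) (g : {rmorphism A -> B})
    (ed fd : nat -> A) (b : int -> nat -> A) : divided_powers ed fd b ->
  divided_powers (g \o ed) (g \o fd) (fun m => g \o b m).
Proof.
case=> e0 f0 ee ff b0 bS ef; split=> [||m n|m n|m|m j|c a] /=.
- by rewrite e0 rmorph1.
- by rewrite f0 rmorph1.
- by rewrite -rmorphM ee rmorphMn.
- by rewrite -rmorphM ff rmorphMn.
- by rewrite b0 rmorph1.
- by rewrite bS rmorphD.
- rewrite -rmorphM ef rmorph_sum; apply: eq_bigr => j _.
  by rewrite !rmorphM.
Qed.

(** * Divided powers over the rationals and in the integral form *)

Section RationalDividedPowers.
Variables (A : algType rat) (e f h : A).

Let fact_neq0 m : (m`!%:R : rat) != 0.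
Proof. by rewrite Num.Theory.pnatr_eq0 -lt0n fact_gt0. Qed.

Lemma divpow0 (x : A) : divpow x 0 = 1.
Proof. by rewrite /divpow invr1 scale1r. Qed.

Lemma divpowM (x : A) m n : divpow x m * divpow x n = divpow x (m + n) *+ 'C(m + n, m).
Proof.
rewrite /divpow -scalerAl -scalerAr -exprD scalerA -scaler_nat scalerA.
congr (_ *: _); rewrite -(@bin_fact (m + n) m) ?leq_addr // addKn !natrM.
have bin_neq0 : 'C(m + n, m)%:R != 0 :> rat.
  by rewrite Num.Theory.pnatr_eq0 -lt0n bin_gt0 leq_addr.
by field; rewrite bin_neq0 !fact_neq0.
Qed.

Lemma binomA0 (x : A) : binomA x 0 = 1.
Proof. by rewrite /binomA big_ord0 invr1 scale1r. Qed.

Lemma binomA_addr0 (x : A) j : binomA (x + 0%:~R) j = binomA x j.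
Proof. by rewrite addr0. Qed.

(** [ffactr_addr1] requires commutativity, so it is applied in a polynomial ring and evaluated at
    [x]. *)
Lemma binomA_pascal (x : A) j : binomA (x + 1) j.+1 = binomA x j.+1 + binomA x j.
Proof.
have := congr1 (horner_alg x) (ffactr_addr1 'X j).
rewrite rmorphD rmorphM /= rmorph_nat !(rmorph_ffactr (horner_alg x)).
rewrite rmorphD rmorph1 /= horner_algX => E.
rewrite /binomA -![\prod_(i < _) _]/(ffactr _ _) E scalerDr; congr (_ + _).
rewrite mulr_natl -scaler_nat scalerA factS natrM invfM mulrAC mulVf ?mul1r //.
by rewrite Num.Theory.pnatr_eq0.
Qed.

Hypotheses (he : brk h e = 2%:R *: e) (hf : brk h f = - (2%:R *: f))
  (ef : brk e f = h).

Lemma brk_exp_succ n : e * f ^+ n.+1 = f ^+ n.+1 * e + f ^+ n * (h - n%:R) *+ n.+1.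
Proof.
have hfE : h * f = f * (h - 2%:R).
  by rewrite -[h * f](subrK (f * h)) -/(brk h f) hf scaler_nat mulrBr mulr_natr addrC.
elim: n => [|n IH].
  by rewrite mul1r subr0 expr1 -ef /brk addrC subrK.
have efE : e * f = f * e + h by rewrite -ef /brk addrC subrK.
rewrite exprSr mulrA IH mulrDl -[f ^+ n.+1 * e * f]mulrA efE mulrDr.
rewrite [f ^+ n.+1 * (f * e)]mulrA -exprSr -addrA; congr (_ + _).
have -> : f ^+ n * (h - n%:R) *+ n.+1 * f = f ^+ n.+1 * (h - 2%:R - n%:R) *+ n.+1.
  rewrite mulrnAl -mulrA mulrBl hfE -[n%:R * f](commr_nat f n) -mulrBr.
  by rewrite mulrA -exprSr.
rewrite -mulrnAr -mulrDr -mulrnAr; congr (_ * _).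
rewrite -addrA -opprD -natrD !mulrnBl addrA -mulrS; congr (_ - _).
by rewrite -!mulrnA; congr (_ *+ _); lia.
Qed.

Lemma e_divpow_succ n : e * divpow f n.+1 = divpow f n.+1 * e + divpow f n * (h - n%:R).
Proof.
rewrite /divpow -scalerAr brk_exp_succ scalerDr -!scalerAl; congr (_ + _).
rewrite -scaler_nat scalerA factS natrM invfM mulrAC mulVf ?mul1r //.
by rewrite Num.Theory.pnatr_eq0.
Qed.

(** This is [mul_exp_divided] for the divided powers of [f], divided by the factorial of [c], which
    turns ['C(c, j)] into the inverse of [j! (c - j)!]. *)
Lemma kostant_commutation c a : divpow e c * divpow f a = \sum_(j < (minn a c).+1)
  divpow f (a - j)%N * binomA (h + (2 * j%:Z - c%:Z - a%:Z)%:~R) j * divpow e (c - j)%N.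
Proof.
have he2 : brk h e = e *+ 2 by rewrite he scaler_nat.
have ed0 : e * divpow f 0 = divpow f 0 * e by rewrite divpow0 mulr1 mul1r.
rewrite {1}/divpow -scalerAl.
rewrite (mul_exp_divided he2 ed0 (N := a) (fun n _ => e_divpow_succ n)) //.
pose F j := divpow f (a - j)%N *
  binomA (h + (2 * j%:Z - c%:Z - a%:Z)%:~R) j * divpow e (c - j)%N.
rewrite [RHS](@big_ord_widen _ _ _ _ c.+1 F) ?ltnS ?geq_minr // [RHS]big_mkcond
  scaler_sumr.
apply: eq_bigr => -[j jc] _; rewrite /= in jc *.
rewrite ltnS leq_min -[(j <= c)%N]/(j < c.+1)%N jc andbT.
case: ifP => _; last by rewrite scaler0.
rewrite /F /binomA -[\prod_(i < j) _]/(ffactr _ _).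
move: (divpow f _) (ffactr _ _) => Df Ff; rewrite /divpow.
rewrite -[RHS]scalerAr -[in RHS]scalerAr -!scalerAl !scalerA -scaler_nat scalerA.
congr (_ *: _); rewrite -(@bin_fact c j) // !natrM.
have bin_neq0 : 'C(c, j)%:R != 0 :> rat.
  by rewrite Num.Theory.pnatr_eq0 -lt0n bin_gt0.
by field; rewrite bin_neq0 !fact_neq0.
Qed.

Lemma rat_divided_powers :
  divided_powers (divpow e) (divpow f) (fun m j => binomA (h + m%:~R) j).
Proof.
split=> [||m n|m n|m|m j|c a].
- exact: divpow0.
- exact: divpow0.
- exact: divpowM.
- exact: divpowM.
- exact: binomA0.
- by rewrite rmorphD addrA; exact: binomA_pascal.
- exact: kostant_commutation.
Qed.

(** The spanning elements contain only unshifted binomials; Pascal's rule reaches the shifted ones,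
    in both directions of [m]. *)
Lemma kostant_form_binom (m : int) (j : nat) : kostant_form e f h (binomA (h +
  m%:~R) j).
Proof.
elim: j m => [|j IH].
  move=> m; have := kostant_form_dive e f h 0.
  by rewrite divpow0 binomA0.
elim/int_ind => [|n IHn|n IHn].
- rewrite addr0.
  have := zspan_mem (kostant_mon e f h) (0%N, j.+1, 0%N).
  by rewrite /kostant_mon /= !divpow0 mul1r mulr1.
- have -> : n.+1%:Z = n%:Z + 1 by rewrite intS addrC.
  rewrite rmorphD addrA binomA_pascal.
  by apply: zspanD; [exact: IHn | exact: IH].
have E : h + (- n%:Z)%:~R = h + (- n.+1%:Z)%:~R + 1.
  have -> : - n%:Z = - n.+1%:Z + 1 by rewrite intS; ring.
  by rewrite rmorphD addrA.
rewrite -[binomA _ _](addrK (binomA (h + (- n.+1%:Z)%:~R) j)) -binomA_pascal -E.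
by apply: zspanD; [exact: IHn | apply/zspanN/IH].
Qed.

End RationalDividedPowers.

(** Serves to pull the identities of the enveloping algebra back to [distZ]. *)
Lemma divided_powers_inj (A B : nzRingType) (g : {rmorphism A -> B})
    (ed fd : nat -> A) (b : int -> nat -> A) : injective g ->
  divided_powers (g \o ed) (g \o fd) (fun m => g \o b m) -> divided_powers ed fd b.
Proof.
move=> gI [/= e0 f0 ee ff b0 bS ef]; split=> [||m n|m n|m|m j|c a]; apply: gI.
- by rewrite e0 rmorph1.
- by rewrite f0 rmorph1.
- by rewrite rmorphM rmorphMn.
- by rewrite rmorphM rmorphMn.
- by rewrite b0 rmorph1.
- by rewrite bS rmorphD.
- rewrite rmorphM ef rmorph_sum; apply: eq_bigr => j _.
  by rewrite !rmorphM.
Qed.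

Section DistZ.
Variables (e f h : sl2 rat) (std : sl2_std_basis e f h).
Local Notation ue := (env_in (@sl2_brk rat) e).
Local Notation uf := (env_in (@sl2_brk rat) f).
Local Notation uh := (env_in (@sl2_brk rat) h).
Local Notation S := (in_distZ std).
Local Notation D := (distZ std).

Lemma distZ_binom (m : int) (j : nat) : binomA (uh + m%:~R) j \in S.
Proof. exact/asboolP/kostant_form_binom. Qed.

Let ed m : D := DistZ (distZ_divpow_e std m).
Let fd m : D := DistZ (distZ_divpow_f std m).
Let bd m j : D := DistZ (distZ_binom m j).

Let dval : {rmorphism D -> env (@sl2_brk rat)} := \val.

Lemma distZ_divided_powers : divided_powers ed fd bd.
Proof.
apply: (divided_powers_inj (g := dval)); first exact: val_inj.
exact: (rat_divided_powers (env_he std) (env_hf std) (env_ef std)).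
Qed.

Definition distZ_kostant (t : nat * nat * nat) : D := fd t.1.1 * bd 0 t.1.2 * ed t.2.

Lemma distZ_kostantE t : distZ_val (distZ_kostant t) = kostant_mon ue uf uh t.
Proof.
transitivity (dval (fd t.1.1 * bd 0 t.1.2) * dval (ed t.2));
  first exact: (rmorphM dval).
rewrite /kostant_mon; apply: (congr1 (fun x => x * dval (ed t.2))).
transitivity (dval (fd t.1.1) * dval (bd 0 t.1.2)); first exact: (rmorphM dval).
exact: (congr1 (fun x => dval (fd t.1.1) * x) (binomA_addr0 uh t.1.2)).
Qed.

End DistZ.

Lemma sum_regroup (K : pzRingType) (V : lmodType K) (T : eqType) (R : seq T)
    (s : seq (K * T)) (F : T -> V) : uniq R -> (forall u, u \in s -> u.2 \in R) ->
  \sum_(u <- s) u.1 *: F u.2 = \sum_(r <- R) (\sum_(u <- s | u.2 == r) u.1) *: F r.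
Proof.
move=> uR; elim: s => [|u s IH] sR.
  by rewrite big_nil big1 // => r _; rewrite big_nil scale0r.
rewrite big_cons IH => [|v vs]; last by apply: sR; rewrite inE vs orbT.
have -> : u.1 *: F u.2 = \sum_(r <- R) (if u.2 == r then u.1 else 0) *: F r.
  rewrite (bigD1_seq u.2) //= ?sR ?mem_head // eqxx big1 ?addr0 // => r.
  by rewrite eq_sym => /negPf ->; rewrite scale0r.
rewrite -big_split /=; apply: eq_bigr => r _; rewrite -scalerDl big_cons.
by case: eqP; rewrite ?add0r.
Qed.

(** * Reduction modulo p of an integral form *)

Section ReductionModP.
Variables (p : nat) (p_pr : prime p) (T : eqType).
Variables (U : lmodType rat) (kost : T -> U).
Hypothesis kost_free : forall (R : seq T) (C : T -> rat), uniq R ->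
  \sum_(t <- R) C t *: kost t = 0 -> forall t, t \in R -> C t = 0.
Variables (D : zmodType) (val : {additive D -> U}) (kostZ : T -> D).
Hypothesis val_inj : injective val.
Hypothesis kostZE : forall t, val (kostZ t) = kost t.
Hypothesis kostZ_span : forall y, zspan kost (val y).
Variables (H : lmodType 'F_p) (red : {additive D -> H}).
Hypothesis red_surj : forall x, exists y, red y = x.
Hypothesis red_ker : forall y, red y = 0 -> exists z, y = z *+ p.

Lemma reduction_span x : exists s : seq (int * T), x =
  \sum_(u <- s) red (kostZ u.2) *~ u.1.
Proof.
have [y <-] := red_surj x; have [s sE] := kostZ_span y; exists s.
transitivity (red (\sum_(u <- s) kostZ u.2 *~ u.1)).
  congr (red _); apply: val_inj; rewrite sE raddf_sum; apply: eq_bigr => u _.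
  by rewrite raddfMz /= kostZE.
by rewrite raddf_sum; apply: eq_bigr => u _; rewrite raddfMz.
Qed.

(** The coefficients lift to integers from 0 to [p - 1], and the lifted combination is [p z].
    Expanding [z] over the integers and comparing in [U] shows that each lifted coefficient is a
    multiple of [p]. *)
Lemma reduction_free (R : seq T) (C : T -> 'F_p) : uniq R ->
  \sum_(t <- R) C t *: red (kostZ t) = 0 -> forall t, t \in R -> C t = 0.
Proof.
move=> uR C0.
have [z zE] : exists z, \sum_(t <- R) kostZ t *+ (C t : nat) = z *+ p.
  apply: red_ker; rewrite -[RHS]C0 raddf_sum; apply: eq_bigr => t _.
  by rewrite raddfMn /= -scaler_nat natr_Zp.
have [s sE] := kostZ_span z.
(* [s'] lists the terms of the lifted combination minus those of [p z]; [R'] gathers their indices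
   without repetition, as [kost_free] requires. *)
pose R' := undup (R ++ map snd s).
pose s' := [seq ((C t : nat)%:R : rat, t) | t <- R] ++ [seq (- (u.1 *+ p)%:~R : rat,
  u.2) | u <- s].
pose c t := \sum_(u <- s' | u.2 == t) u.1.
have uR' : uniq R' by exact: undup_uniq.
have sR' u : u \in s' -> u.2 \in R'.
  rewrite mem_undup !mem_cat => /orP[/mapP[t tR ->]|/mapP[v vs ->]];
    first by rewrite tR.
  by rewrite /= map_f ?orbT.
have c0 : \sum_(t <- R') c t *: kost t = 0.
  rewrite -(sum_regroup _ uR' sR') big_cat !big_map /=.
  have -> : \sum_(t <- R) (C t : nat)%:R *: kost t = val (z *+ p).
    rewrite -zE raddf_sum; apply: eq_bigr => t _.
    by rewrite raddfMn /= kostZE scaler_nat.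
  rewrite raddfMn /= sE -sumrMnl -big_split big1 // => u _ /=.
  by rewrite scaleNr scaler_int -[u.1 *+ p]mulr_natr natz mulrzA -pmulrn subrr.
move=> t tR; have tR' : t \in R' by rewrite mem_undup mem_cat tR.
have := kost_free uR' c0 tR'; rewrite /c big_cat !big_map /=.
rewrite (big_rem t tR) /= eqxx.
have -> : \sum_(j <- rem t R | j == t) ((C j : nat)%:R : rat) = 0.
  rewrite big_seq_cond big1 // => j /andP[jR /eqP jt].
  by move: jR; rewrite jt mem_rem_uniqF.
rewrite addr0 sumrN => /eqP; rewrite subr_eq0 -rmorph_sum /= pmulrn eqr_int => /eqP Ct.
have pC : (p%:Z %| (C t : nat)%:Z)%Z.
  by rewrite Ct; apply: rpred_sum => u _; rewrite -mulr_natr natz dvdz_mull.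
apply/eqP; rewrite -[C t]natr_Zp.
by rewrite -(dvdn_pcharf (pchar_Fp p_pr)); move: pC; rewrite dvdzE.
Qed.

End ReductionModP.

(** * From Kostant's basis to the presentation *)

Section Presentation.
Variables (p : nat) (p_pr : prime p) (A : algType 'F_p) (gen : nat + nat -> A).
Variables (ed fd : nat -> A) (B : int -> nat -> A).
Hypothesis dp : divided_powers ed fd B.
Hypothesis gen_e : forall k, gen (inl k) = ed (p ^ k).
Hypothesis gen_f : forall k, gen (inr k) = fd (p ^ k).

Let kost (t : nat * nat * nat) := fd t.1.1 * B 0 t.1.2 * ed t.2.

Hypothesis kost_span : forall x, exists s : seq (int * (nat * nat * nat)),
  x = \sum_(u <- s) kost u.2 *~ u.1.
Hypothesis kost_free : forall (R : seq (nat * nat * nat)) (C : nat * nat * nat -> 'F_p),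
  uniq R -> \sum_(t <- R) C t *: kost t = 0 -> forall t, t \in R -> C t = 0.

Let e k := ed (p ^ k).
Let f k := fd (p ^ k).

Let gE : (fun k => gen (inl k)) = e. Proof. exact/funext/gen_e. Qed.
Let gF : (fun k => gen (inr k)) = f. Proof. exact/funext/gen_f. Qed.

Let sub_level_kost N t : (t.1.1 < p ^ N)%N -> (t.1.2 < p ^ N)%N -> (t.2 < p ^ N)%N ->
  sub_level e f N (kost t).
Proof.
move=> aN bN cN; apply: sub_levelM; last exact: (sub_level_ed p_pr dp).
by apply: sub_levelM; [exact: (sub_level_fd p_pr dp) | exact: (sub_level_B p_pr dp)].
Qed.

Let span x : exists N, sub_level e f N x.
Proof.
have [s ->] := kost_span x; pose w (t : nat * nat * nat) := (t.1.1 + t.1.2 + t.2)%N.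
have : forall u, u \in s -> (w u.2 <= \max_(u <- s) w u.2)%N.
  by move=> u us; rewrite (big_rem u us) leq_maxl.
move: (\max_(_ <- _) _) => N sN; exists N; rewrite big_seq.
apply: big_ind; [exact: lspan0 | by move=> y z;
  exact: lspanD | move=> [n [[a b] c]] /sN].
rewrite -scaler_int /w /= => uN; apply: lspanZ.
(* [N] bounds the sum of the three indices, and [N < p ^ N], so each index is below [p ^ N]. *)
have Np := ltn_expl N (prime_gt1 p_pr).
by apply: sub_level_kost; apply: leq_ltn_trans Np; apply: leq_trans uN; rewrite /=; lia.
Qed.

Let box N : seq (nat * nat * nat) :=
  [seq (ab, c) | ab <- [seq (a, b) | a <- iota 0 (p ^ N), b <- iota 0 (p ^ N)],
                 c <- iota 0 (p ^ N)].

Let size_box N : size (box N) = (p ^ N * p ^ N * p ^ N)%N.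
Proof. by rewrite !size_allpairs !size_iota. Qed.

Let uniq_box N : uniq (box N).
Proof.
apply: allpairs_uniq; rewrite ?iota_uniq //; last by move=> [? ?] [? ?] _ _ [-> ->].
by apply: allpairs_uniq; rewrite ?iota_uniq // => -[? ?] [? ?] _ _ [-> ->].
Qed.

(** [spanning_free] applies: Kostant's elements with indices in the box are independent, lie in the
    span of the monomials, and are equal to them in number. *)
Let free N (c : nat -> 'F_p) :
  \sum_(i < size (monomials p e f N)) c i *: (monomials p e f N)`_i = 0 ->
  forall i, (i < size (monomials p e f N))%N -> c i = 0.
Proof.
apply: (spanning_free (u := map kost (box N))).
- by rewrite size_monomials size_map size_box.
- move=> _ /mapP[t /allpairsP[[ab d] [/= /allpairsP[[a b] [/= aN bN ->]] dN ->]] ->].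
  apply: (sub_level_span p_pr (divided_powers_rel p_pr dp)).
  by apply: sub_level_kost; move: aN bN dN; rewrite !mem_iota.
move=> {}c; rewrite size_map => c0 i iN.
pose C t := c (index t (box N)).
have tN := mem_nth (0, 0, 0)%N iN.
rewrite -(index_uniq (0, 0, 0)%N iN (uniq_box N)) -/(C _).
apply: (kost_free (uniq_box N) _ tN); rewrite -[RHS]c0 (big_nth (0, 0, 0)%N) big_mkord.
apply: eq_bigr => j _; rewrite /C index_uniq //.
by rewrite (nth_map (0, 0, 0)%N).
Qed.

Lemma presented_by_divided_powers :
  presented_by gen (dist_rel p (free_e p) (free_f p)).
Proof.
apply: presented_by_monomials => //; rewrite ?gE ?gF.
- exact: (divided_powers_rel p_pr dp).
- exact: free.
- exact: span.
Qed.

End Presentation.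

Theorem theorem1 (p : nat) (p_pr : prime p) (p_ge3 : (3 <= p)%N)
    (g : 'M['F_p]_2) (g_unit : g \in unitmx)
    (e f h : sl2 'F_p) (efh_std : sl2_std_basis e f h)
    (h_spans : forall x : sl2 'F_p,
       torus_Lie g x <-> exists c : 'F_p, x = c *: h)
    (E F H : sl2 rat) (EFH_std : sl2_std_basis E F H)
    (liftE : sl2_lift e E) (liftF : sl2_lift f F) (liftH : sl2_lift h H) :
  presented_by (A := dist EFH_std p_pr) (dist_gen EFH_std p_pr)
    (dist_rel p (free_e p) (free_f p)).
Proof.
pose red : {rmorphism distZ EFH_std -> dist EFH_std p_pr} :=
  to_quot2 (in_pdistZ p_pr).
pose val : {rmorphism distZ EFH_std -> env (@sl2_brk rat)} := \val.
pose u := env_in (@sl2_brk rat).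
have red_ker y : red y = 0 -> exists z, y = z *+ p.
  by rewrite -(raddf0 red) => /to_quot2_eq; rewrite subr0 => /asboolP.
have red_surj x : exists y, red y = x.
  by exists (rep2 (x : quot2 (in_pdistZ p_pr))); exact: rep2K.
have val_span y : zspan (kostant_mon (u E) (u F) (u H)) (val y).
  by case: y => y yS; apply/asboolP.
have kE := distZ_kostantE EFH_std.
have redM x y z : red (x * y * z) = red x * red y * red z.
  exact: etrans (rmorphM red _ _) (congr1 (fun w => w * red z) (rmorphM red x y)).
(* The identities between divided powers hold integrally and pass to the quotient by [p]. *)
have dp := divided_powers_map red (distZ_divided_powers EFH_std).
apply: (presented_by_divided_powers p_pr dp) => // [x|R C uR S0].
  have [s ->] := reduction_span val_inj kE val_span red_surj x.
  by exists s; apply: eq_bigr => v _; congr (_ *~ _); exact: redM.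
have free := @reduction_free p p_pr _ _ _ (env_kostant_free EFH_std) _ val _ kE
  val_span.
apply: (free _ red red_ker R C uR); apply: etrans S0.
by apply: eq_bigr => t _; congr (_ *: _); exact: redM.
Qed.
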